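(* For every $n\ge0$, the multiplication defined by the maps $m_{c,b,a}$ makes the graded abelian group $H^n$ into a $\mathbb Z_+$-graded associative unital ring (with unit $1=\sum_{a\in B^n}1_a$).
   Context: $G\{k\}$ denotes the shift $G\{k\}_i=G_{i-k}$ of a graded abelian group; tensor products are over $\mathbb Z$; $\mathbb Z_+$ denotes the nonnegative integers. $\mathcal A$ is the free abelian group on $\mathbf 1,X$ with $\deg\mathbf 1=-1$, $\deg X=1$, commutative ring structure with unit $\mathbf 1$ and $X^2=0$; $\iota(1)=\mathbf 1$; $\epsilon(\mathbf 1)=0,\epsilon(X)=1$; $\Delta(\mathbf 1)=\mathbf 1\otimes X+X\otimes\mathbf 1$, $\Delta(X)=X\otimes X$. $\mathcal F$ is the associated two-dimensional TQFT (functor from two-dimensional oriented cobordisms between closed 1-manifolds to graded abelian groups), sending $k$ circles to $\mathcal A^{\otimes k}$ and the merging pair of pants, splitting pair of pants, birth disc, death disc to multiplication, $\Delta$, $\iota$, $\epsilon$; $\mathcal F(S)$ has degree $-\chi(S)$. It is applied to closed 1-manifolds in $\mathbb R^2$ and cobordisms between them embedded in $\mathbb R^2\times[0,1]$ (which carry a natural orientation: an outermost circle in the plane is oriented counterclockwise and orientations alternate with the parity of the number of separating components, and similarly for surfaces). $B^n$ is a set of representatives of isotopy classes of crossingless matchings: embeddings of $n$ disjoint arcs in $\mathbb R\times[0,1]$ pairing the $2n$ points $1,\dots,2n$ on $\mathbb R\times\{1\}$. $W$ is reflection about $\mathbb R\times\{1/2\}$. $W(b)a$ is the concatenation with $W(b)$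 on top of $a$, a closed 1-manifold in the plane. $\mathrm{Vert}_{2n}$ is the diagram of $2n$ vertical segments. $S(b)$, $b\in B^n$, is the minimal cobordism, embedded in $\mathbb R\times[0,1]\times[0,1]$, from $bW(b)$ to $\mathrm{Vert}_{2n}$, diffeomorphic to a disjoint union of $n$ discs ($n$ saddle points). $H^n=\bigoplus_{a,b\in B^n}{}_b(H^n)_a$ with ${}_b(H^n)_a=\mathcal F(W(b)a)\{n\}$. Multiplication: $uv=0$ if $u\in{}_d(H^n)_c$, $v\in{}_b(H^n)_a$, $c\ne b$; and $m_{c,b,a}:{}_c(H^n)_b\otimes{}_b(H^n)_a\to{}_c(H^n)_a$ is the (grading-preserving) map $\mathcal F(W(c)b)\{n\}\otimes\mathcal F(W(b)a)\{n\}\cong\mathcal F(W(c)bW(b)a)\{2n\}\to\mathcal F(W(c)a)\{n\}$ induced by the cobordism $\mathrm{Id}_{W(c)}S(b)\mathrm{Id}_a$ from $W(c)bW(b)a$ to $W(c)a$. The element $1_a\in{}_a(H^n)_a$ is $\mathbf 1^{\otimes n}\{n\}\in\mathcal A^{\otimes n}\{n\}\cong{}_a(H^n)_a$. *)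

(* Defs.v *)
From HB Require Import structures.
From mathcomp Require Import all_boot all_order all_algebra.

Set Implicit Arguments.
Unset Strict Implicit.
Unset Printing Implicit Defensive.

Import Order.TTheory GRing.Theory Num.Theory.
Local Open Scope ring_scope.

(** * Free abelian groups *)

(* The free abelian group on a finite type T is {ffun T -> int}. *)
Definition basis_elt (T : finType) (t : T) : {ffun T -> int} :=
  [ffun s => (s == t)%:Z].

(** * The Frobenius algebra A *)

(* The basis (1, X) of A is indexed by bool: false stands for 1, true for X;
   A (x) A has basis bool * bool.  mulA and DeltaA give the structure maps on
   basis elements. *)
Definition degA (x : bool) : int := if x then 1 else - 1.

Definition mulA (x y : bool) : {ffun bool -> int} :=
  match x, y with
  | false, _ => basis_elt y
  | true, false => basis_elt true
  | true, true => 0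
  end.

Definition DeltaA (x : bool) : {ffun bool * bool -> int} :=
  if x then basis_elt (true, true)
  else basis_elt (false, true) + basis_elt (true, false).

(** * Closed 1-manifolds and the TQFT F *)

(* A closed 1-manifold cut at a finite set V of marked points (at least one on
   each circle) into arcs: every point v lies on two arcs, one leaving v
   downwards, with other endpoint [dn v], the other one leaving v upwards, with
   other endpoint [up v]. *)
Record curve (V : finType) := Curve { dn : V -> V; up : V -> V }.

Section TQFT.
Variable V : finType.
Implicit Types D : curve V.

Definition arc D : rel V := [rel u v | (dn D u == v) || (up D u == v)].

Definition circle_set D (v : V) : {set V} := [set w | connect (arc D) v w].

Definition circle D : Type := {C : {set V} | C \in [set circle_set D v | v in V]}.

Definition circle_of D (v : V) : circle D :=
  exist _ (circle_set D v) (imset_f (circle_set D) (isT : v \in V)).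

(* A labeling f is the basis element of A^{(x) circles} that has the factor
   f C at the circle C. *)
Definition labeling D : Type := {ffun circle D -> bool}.

Definition deg_labeling D (f : labeling D) : int := \sum_(C : circle D) degA (f C).

Definition F D : Type := {ffun labeling D -> int}.

(* The saddle that fuses the upward arc p -- up p with the downward arc
   p' -- dn p', producing the arcs p -- p' and up p -- dn p'. *)
Definition saddle D (p p' : V) : curve V :=
  let q := up D p in let q' := dn D p' in
  Curve (fun v => if v == p' then p else if v == q' then q else dn D v)
        (fun v => if v == p then p' else if v == q then q' else up D v).

(* F of this saddle on a basis element f.  Circles away from the saddle keep
   their labels.  If the two arcs lie on different circles, these merge; if
   they lie on the same circle, it splits into the circles through p and
   through up p. *)
Definition F_saddle_basis D (p p' : V) (f : labeling D) : F (saddle D p p') :=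
  let D' := saddle D p p' in
  [ffun g : labeling D' =>
    if [forall v, (circle_of D v != circle_of D p) &&
                  (circle_of D v != circle_of D p') ==>
                  (g (circle_of D' v) == f (circle_of D v))]
    then if circle_of D p != circle_of D p'
         then mulA (f (circle_of D p)) (f (circle_of D p')) (g (circle_of D' p))
         else DeltaA (f (circle_of D p))
                     (g (circle_of D' p), g (circle_of D' (up D p)))
    else 0].

Definition F_saddle D (p p' : V) (x : F D) : F (saddle D p p') :=
  \sum_(f : labeling D) F_saddle_basis p p' f *~ x f.

Definition saddles D (s : seq (V * V)) : curve V :=
  foldl (fun D pp => saddle D pp.1 pp.2) D s.

(* F of a composition of saddles, the head of s being performed first. *)
Fixpoint F_saddles (s : seq (V * V)) D : F D -> F (saddles D s) :=
  match s return F D -> F (saddles D s) with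
  | [::] => fun x => x
  | pp :: s' => fun x => F_saddles s' (F_saddle pp.1 pp.2 x)
  end.

End TQFT.

(* The labelings f and g agree along a map h that sends the marked points of D'
   to marked points of D. *)
Definition agree (V V' : finType) (h : V' -> V) (D : curve V) (D' : curve V')
    (f : labeling D) (g : labeling D') : bool :=
  [forall v, f (circle_of D (h v)) == g (circle_of D' v)].

(* The isomorphism F(D) -> F(D') for two subdivisions of one 1-manifold,
   identified along h: the sum has a single term when h induces a bijection
   of circles. *)
Definition F_iso (V V' : finType) (h : V' -> V) (D : curve V) (D' : curve V')
    (x : F D) : F D' :=
  [ffun g => \sum_(f : labeling D | agree h f g) x f].

Definition disjoint_union (V1 V2 : finType) (D1 : curve V1) (D2 : curve V2) :
    curve (V1 + V2)%type :=
  Curve (fun v => match v with inl u => inl (dn D1 u) | inr u => inr (dn D2 u) end)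
        (fun v => match v with inl u => inl (up D1 u) | inr u => inr (up D2 u) end).

(* F(D1) (x) F(D2) -> F(D1 + D2): a labeling of D1 + D2 restricts to exactly one
   labeling of each summand, so again the sums have a single term. *)
Definition F_tensor (V1 V2 : finType) (D1 : curve V1) (D2 : curve V2)
    (x : F D1) (y : F D2) : F (disjoint_union D1 D2) :=
  [ffun f => \sum_(g1 : labeling D1 | agree inl f g1)
             \sum_(g2 : labeling D2 | agree inr f g2) x g1 * y g2].

(** * Crossingless matchings *)

Definition crossingless (m : nat) (b : {ffun 'I_m -> 'I_m}) : bool :=
  [&& [forall i, b (b i) == i],
      [forall i, b i != i]
    & [forall i : 'I_m, forall j : 'I_m, ~~ [&& i < j, j < b i & b i < b j]%N]].

(* B^n: an isotopy class of crossingless matchings is determined by the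
   fixed-point-free involution exchanging the two endpoints of each arc. *)
Record matching (n : nat) := Matching {
  partner :> {ffun 'I_(2 * n) -> 'I_(2 * n)};
  _ : crossingless partner }.
HB.instance Definition _ n := [isSub for @partner n].
HB.instance Definition _ n := [Countable of matching n by <:].
HB.instance Definition _ n := [Finite of matching n by <:].

(* W(b)a, marked at the 2n points where a (below) and W(b) (above) meet. *)
Definition Wcat (n : nat) (b a : matching n) : curve 'I_(2 * n) := Curve a b.

(* S(b) is a disjoint union of n discs, one for each arc {i, b i} of b, and
   each disc is a saddle that fuses the copies of this arc in W(b) and in b
   into two vertical segments.  A presentation of S(b) as a composition of
   saddles is thus an ordering of the arcs of b; arcs are represented by their
   left endpoints. *)
Definition saddle_order (n : nat) (b : matching n) (s : seq 'I_(2 * n)) : bool :=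
  perm_eq s [seq i : 'I_(2 * n) <- enum 'I_(2 * n) | (i < b i)%N].

(** * The ring H^n *)

Section ArcRing.
Variable n : nat.
Implicit Types a b c : matching n.

(* Homogeneous basis of H^n: a pair (b, a) and a labeling of W(b)a. *)
Definition Hbasis : Type :=
  {ba : matching n * matching n & labeling (Wcat ba.1 ba.2)}.

Definition H : Type := {ffun Hbasis -> int}.
HB.instance Definition _ := GRing.Zmodule.on H.

Definition Hbasis_elt b a (f : labeling (Wcat b a)) : Hbasis :=
  existT (fun ba => labeling (Wcat ba.1 ba.2)) (b, a) f.

(* The component of x in the summand _b(H^n)_a. *)
Definition component (x : H) b a : F (Wcat b a) := [ffun f => x (Hbasis_elt f)].

(* The degree in F(W(b)a){n}. *)
Definition degH (t : Hbasis) : int := deg_labeling (tagged t) + n%:Z.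

Definition homogH (d : int) (x : H) : Prop := forall t, x t != 0 -> degH t = d.

(* s b is an ordering of the arcs of b, which presents S(b). *)
Variable s : matching n -> seq 'I_(2 * n).

(* m_{c,b,a}.  W(c)bW(b)a is the disjoint union of W(b)a (points inl i) and
   W(c)b (points inr i) placed above it; for each arc {i, b i} of b, the upward
   arc of inl i is fused with the downward arc of inr i.  The result is
   W(c) Vert a, which is identified with W(c)a through the points inl i. *)
Definition mH c b a (x : F (Wcat c b)) (y : F (Wcat b a)) : F (Wcat c a) :=
  F_iso inl (Wcat c a)
    (F_saddles [seq (inl i, inr i) | i <- s b] (F_tensor y x)).

Definition mulH (x y : H) : H :=
  [ffun t : Hbasis =>
    \sum_(b : matching n)
      mH (component x (tag t).1 b) (component y b (tag t).2) (tagged t)].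

Definition idemH a : H :=
  basis_elt (Hbasis_elt ([ffun=> false] : labeling (Wcat a a))).

Definition oneH : H := \sum_(a : matching n) idemH a.
End ArcRing.

(** * Graded rings *)

(* The subgroups Gr i, for i : int, form an internal grading of G. *)
Record graded_group (G : zmodType) (Gr : int -> G -> Prop) : Prop := {
  graded0 : forall i, Gr i 0;
  gradedB : forall i x y, Gr i x -> Gr i y -> Gr i (x - y);
  graded_span : forall x, exists (I : seq int) (z : int -> G),
    [/\ uniq I, forall i, Gr i (z i) & x = \sum_(i <- I) z i];
  graded_direct : forall (I : seq int) (z : int -> G),
    uniq I -> (forall i, Gr i (z i)) -> \sum_(i <- I) z i = 0 ->
    forall i, i \in I -> z i = 0 }.

(* mul and one make the additive group G, graded by Gr, into an associative
   unital ring graded by the nonnegative integers. *)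
Record nonneg_graded_ring (G : zmodType) (Gr : int -> G -> Prop)
    (mul : G -> G -> G) (one : G) : Prop := {
  ring_graded : graded_group Gr;
  ring_nonneg : forall i x, i < 0 -> Gr i x -> x = 0;
  ring_mulDl : left_distributive mul +%R;
  ring_mulDr : right_distributive mul +%R;
  ring_mulA : associative mul;
  ring_mul1l : left_id one mul;
  ring_mul1r : right_id one mul;
  ring_gradedM : forall i j x y, Gr i x -> Gr j y -> Gr (i + j) (mul x y);
  ring_graded1 : Gr 0 one }.

(* Main.v *)
(* F(D) is a cyclic module over the polynomial ring in variables X_v, one for
   each marked point v, generated by the labeling with all labels 1; every map
   entering the multiplication is linear over it.  A merge sends the generator
   to the generator, and a split sends it to (X_p + X_q) times the generator, p
   and q being the two ends of an arc that is cut.  Hence m_{c,b,a} is determined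
   by the set of the arcs of b at which a circle splits, and associativity
   becomes an identity between two products of factors X_p + X_q in F(W(d)a).
   To prove it, perform the b-saddles and the c-saddles on W(d)cW(c)bW(b)a in both
   orders: two saddles on disjoint arcs commute, because the type of each can only
   change when all the arcs involved come together, and then the two factors
   agree in the target.

   Orienting the circles (upwards at the points of one parity) turns a curve into
   a permutation of its marked points and a saddle into the multiplication by a
   transposition, so that it changes the number of circles by one.  This count
   also gives the degrees; the unit laws hold because the circles of W(a)a are
   {i, a i}, so that only merges occur. *)

From HB Require Import structures.
From mathcomp Require Import all_boot all_order all_algebra all_fingroup.
From mathcomp Require Import zify.
Require Import Defs.

Set Implicit Arguments.
Unset Strict Implicit.
Unset Printing Implicit Defensive.

Import Order.TTheory GRing.Theory Num.Theory.
Local Open Scope ring_scope.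

(** * Oriented curves *)

(** The main obstacle is typing: F(D) depends on D, and two orders of the same saddles end in curves
    whose arcs agree only pointwise, so their values live in different modules. Saddles, however,
    never change the set of marked points. The effect of a sequence of saddles on the generator is
    therefore recorded as a list of pairs of points ([theta]), which belongs to no particular F(D).
    Such lists are compared through their action on the generator of one target ([word_eq]), and the
    comparison is transported along a [subdivision]. Linearity over the X_v expresses the Frobenius
    property of A, and X_p + X_q is Delta(1). The parity orientation excludes a saddle that would
    turn one circle into one circle, to which the TQFT assigns nothing. Planarity enters through
    [odd_matching], which makes that orientation coherent. *)

Section Oriented.
Variables (V : finType) (o : pred V).
Implicit Types (D : curve V) (u v w p : V).

Definition conn D u v := connect (arc D) u v.

Definition fwd D v := if o v then up D v else dn D v.
Definition bwd D v := if o v then dn D v else up D v.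
(** A [curve] consists of two bare functions. This one condition says both that they describe arcs,
    each seen consistently from its two ends, and that [o] orients these arcs coherently. *)
Definition oriented D := cancel (fwd D) (bwd D).

Lemma bwdK D : oriented D -> cancel (bwd D) (fwd D).
Proof.
by move=> oD; have [g nK gK] := injF_bij (can_inj oD) => v; rewrite -{1}(gK v) oD gK.
Qed.

Lemma arcE D u v : oriented D -> arc D u v = (fwd D u == v) || (fwd D v == u).
Proof.
move=> oD; have -> : (fwd D v == u) = (bwd D u == v).
  by apply/eqP/eqP => <-; rewrite ?oD ?bwdK.
by rewrite /arc /fwd /bwd /=; case: (o u); rewrite // orbC.
Qed.

Definition fwd_perm D (oD : oriented D) : {perm V} := perm (can_inj oD).

Lemma conn_fconnect D u v : oriented D -> conn D u v = fconnect (fwd D) u v.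
Proof.
move=> oD; have sym := fconnect_sym (can_inj oD).
apply/idP/idP; apply: connect_sub => {u v} u v.
  by rewrite arcE // => /orP[] /eqP <-; rewrite ?[fconnect _ _ u]sym ?fconnect1 // sym fconnect1.
by move/eqP=> <-; apply: connect1; rewrite arcE // eqxx.
Qed.

Lemma conn_porbit D (oD : oriented D) u v : conn D u v = (v \in porbit (fwd_perm oD) u).
Proof.
rewrite conn_fconnect //; apply/idP/porbitP => [/iter_findex <-|[i ->]].
  exists (findex (fwd D) u v); rewrite permX; apply: eq_iter => w.
  by rewrite permE.
rewrite permX (eq_iter (f' := fwd D)) ?fconnect_iter // => w.
by rewrite permE.
Qed.

Lemma conn_sym D : oriented D -> connect_sym (arc D).
Proof.
move=> oD u v; rewrite -/(conn D u v) -/(conn D v u) !conn_fconnect //.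
exact/fconnect_sym/can_inj/oD.
Qed.

Lemma connC D u v : oriented D -> conn D u v = conn D v u.
Proof. by move=> oD; apply: conn_sym. Qed.

Lemma conn_refl D u : conn D u u. Proof. exact: connect0. Qed.

Lemma conn_dn D u : conn D u (dn D u).
Proof. by apply: connect1; rewrite /arc /= eqxx. Qed.

Lemma conn_up D u : conn D u (up D u).
Proof. by apply: connect1; rewrite /arc /= eqxx orbT. Qed.

Lemma circle_of_eq D u v : oriented D -> (circle_of D u == circle_of D v) = conn D u v.
Proof.
move=> oD; rewrite -val_eqE /=; apply/eqP/idP => [E|c].
  have : v \in circle_set D u by rewrite E inE connect0.
  by rewrite inE.
by apply/setP => w; rewrite !inE (same_connect (conn_sym oD) c).
Qed.

Lemma circleP D (C : circle D) : exists v, circle_of D v == C.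
Proof. by case: C => C /= /[dup] /imsetP[v _ E] CP; exists v; apply/eqP/val_inj. Qed.

Definition repr D (C : circle D) : V := xchoose (circleP C).

Lemma reprK D (C : circle D) : circle_of D (repr C) = C.
Proof. exact/eqP/(xchooseP (circleP C)). Qed.

Lemma card_circle D (oD : oriented D) : #|{: circle D}| = #|porbits (fwd_perm oD)|.
Proof.
rewrite card_sig; apply: eq_card => C; rewrite inE.
apply/imsetP/imsetP => -[v _ ->]; exists v => //; apply/setP => w.
  by rewrite inE -conn_porbit.
by rewrite inE -conn_porbit.
Qed.


(* A saddle is compatible with the orientation when the two arcs involved lie
   entirely above, resp. below, their endpoints and are antiparallel. *)
Definition legit D (m : V * V) :=
  [&& o m.1 == o m.2, o (up D m.1) != o m.1 & o (dn D m.2) != o m.2].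

Section Saddle.
Variables (D : curve V) (p p' : V).
Hypotheses (oD : oriented D) (legD : legit D (p, p')).
Local Notation q := (up D p).
Local Notation q' := (dn D p').
Local Notation D' := (saddle D p p').

Lemma up_up : up D q = p.
Proof.
have /and3P[_ /= oq _] := legD; move: (oD p) (bwdK oD p) oq.
by rewrite /fwd /bwd; case: (o p) => + + oq; rewrite ?(negPf oq) //; case: (o q) oq.
Qed.

Lemma dn_dn : dn D q' = p'.
Proof.
have /and3P[_ /= _ oq] := legD; move: (oD p') (bwdK oD p') oq.
by rewrite /fwd /bwd; case: (o p') => + + oq; rewrite ?(negPf oq) //; case: (o q') oq.
Qed.

(** The tails of the two arcs for the orientation. Being antiparallel, the arcs start at [p] and
    [q'] if [p] is oriented upwards, and at [p'] and [q] otherwise. The saddle exchanges their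
    heads, so it precomposes [fwd] with the transposition of the tails. *)
Definition cut1 := if o p then p else p'.
Definition cut2 := if o p then q' else q.

Lemma fwd_saddle v : fwd D' v = fwd D (tperm cut1 cut2 v).
Proof.
have /and3P[/= /eqP pp oq oq'] := legD.
rewrite /cut1 /cut2; case op : (o p); rewrite -pp op in oq oq' *.
- rewrite eqb_id in oq; rewrite eqb_id in oq'.
  case: tpermP => [->|->|/eqP np /eqP nq'].
  + by rewrite /fwd op (negPf oq') /= eqxx dn_dn.
  + rewrite /fwd op (negPf oq') /= eqxx.
    by case: eqP oq' => // ->; rewrite -pp op.
  rewrite /fwd /=; case: ifP => ov.
    rewrite (negPf np); case: eqP => // E; by rewrite -E ov in oq.
  by case: eqP => [E|]; [rewrite E -pp op in ov | rewrite (negPf nq')].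
- rewrite eqbF_neg negbK in oq; rewrite eqbF_neg negbK in oq'.
  case: tpermP => [->|->|/eqP np /eqP nq'].
  + by rewrite /fwd -pp op oq /= eqxx up_up.
  + rewrite /fwd -pp op oq /= eqxx.
    by case: eqP oq => // ->; rewrite op.
  rewrite /fwd /=; case: ifP => ov.
    by case: eqP => [E|]; [rewrite E op in ov | rewrite (negPf nq')].
  by rewrite (negPf np); case: eqP => // E; rewrite E oq' in ov.
Qed.

Lemma bwd_saddle v : bwd D' v = tperm cut1 cut2 (bwd D v).
Proof.
have /and3P[/= /eqP pp oq oq'] := legD.
rewrite /cut1 /cut2; case op : (o p); rewrite -pp op in oq oq' *.
- rewrite eqb_id in oq; rewrite eqb_id in oq'.
  have [->|np] := eqVneq v p'.
    by rewrite /bwd -pp op /= eqxx tpermR.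
  have [->|nq] := eqVneq v q.
    rewrite /bwd (negPf oq) /= eqxx up_up tpermL.
    by case: eqP oq => // ->; rewrite op.
  rewrite tpermD.
  + rewrite /bwd /=; case: ifP => ov; last first.
      by rewrite (negPf nq); case: eqP => // E; rewrite E op in ov.
    rewrite (negPf np); case: eqP => // E; rewrite E in ov.
    by rewrite ov in oq'.
  + by apply: contra_neq nq => E; rewrite -(bwdK oD v) -E /fwd op.
  + by apply: contra_neq np => E; rewrite -(bwdK oD v) -E /fwd (negPf oq') dn_dn.
- rewrite eqbF_neg negbK in oq; rewrite eqbF_neg negbK in oq'.
  have [->|np] := eqVneq v p.
    by rewrite /bwd op /= eqxx tpermR.
  have [->|nq] := eqVneq v q'.
    rewrite /bwd oq' /= eqxx dn_dn tpermL.
    by case: eqP oq' => // ->; rewrite -pp op.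
  rewrite tpermD.
  + rewrite /bwd /=; case: ifP => ov; last first.
      by rewrite (negPf np); case: eqP => // E; rewrite E oq in ov.
    rewrite (negPf nq); case: eqP => // E; rewrite E in ov.
    by rewrite -pp op in ov.
  + by apply: contra_neq nq => E; rewrite -(bwdK oD v) -E /fwd -pp op.
  + by apply: contra_neq np => E; rewrite -(bwdK oD v) -E /fwd oq up_up.
Qed.

Lemma oriented_saddle : oriented D'.
Proof. by move=> v; rewrite bwd_saddle fwd_saddle oD tpermK. Qed.

Lemma cut_neq : cut1 != cut2.
Proof.
have /and3P[/= /eqP pp oq oq'] := legD; rewrite /cut1 /cut2.
case op: (o p); [apply: contraNneq oq' | apply: contraNneq oq] => <-.
  by rewrite pp.
by rewrite pp.
Qed.

Lemma fwd_perm_saddle (oD' : oriented D') :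
  fwd_perm oD' = (tperm cut1 cut2 * fwd_perm oD)%g.
Proof. by apply/permP => v; rewrite permM [LHS]permE [RHS]permE fwd_saddle. Qed.

(* conn is unchanged along the four arcs involved, hence may be tested at p
   and p', or at p and q, instead of the two cut points. *)
Lemma conn_cut : conn D cut1 cut2 = conn D p p'.
Proof.
have sym := conn_sym oD.
have pq : conn D p q by exact: conn_up.
have pq' : conn D p' q' by exact: conn_dn.
rewrite /cut1 /cut2 /conn; case: (o p).
  by rewrite -(same_connect_r sym pq').
by rewrite -(same_connect_r sym pq) sym.
Qed.

Lemma conn_saddle_p : conn D' p p'.
Proof. by apply: connect1; rewrite /arc /= !eqxx orbT. Qed.

Lemma conn_saddle_q : conn D' q q'.
Proof.
have /negPf nqp : q != p.
  by have /and3P[/= _ + _] := legD; apply: contraNneq => ->.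
by apply: connect1; rewrite /arc /= nqp !eqxx orbT.
Qed.

Lemma conn_cut_saddle : conn D' cut1 cut2 = conn D' p q.
Proof.
have sym := conn_sym oriented_saddle.
rewrite /cut1 /cut2 /conn; case: (o p).
  by rewrite (same_connect_r sym conn_saddle_q).
by rewrite (same_connect sym conn_saddle_p).
Qed.

(** A transposition merges two cycles or splits one. The doubled boolean makes up for a change of -1
    instead of +1 in the case of a merge, so that no subtraction occurs. *)
Lemma card_circle_saddle :
  (#|{: circle D'}| + (~~ conn D p p').*2 = #|{: circle D}| + 1)%N.
Proof.
rewrite !(card_circle oD, card_circle oriented_saddle) (fwd_perm_saddle oriented_saddle).
have := porbits_mul_tperm (fwd_perm oD) cut1 cut2.
rewrite cut_neq porbit_sym -conn_porbit conn_cut /=; exact.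
Qed.

(** The same transposition leads back from the new curve to the old one, so the cycle count applies
    in both directions; the two counts are compatible only if merges are undone by splits and
    conversely. *)
Lemma conn_split : conn D' p q = ~~ conn D p p'.
Proof.
have := porbits_mul_tperm (fwd_perm oriented_saddle) cut1 cut2.
rewrite cut_neq porbit_sym -conn_porbit conn_cut_saddle /=.
rewrite {1}(fwd_perm_saddle oriented_saddle) mulgA tperm2 mul1g -!card_circle.
have := card_circle_saddle.
case: (conn D p p'); case: (conn D' p q) => //=; rewrite ?addn0 ?addnS => + /esym; lia.
Qed.

(** A circle that avoids both arcs contains neither cut point, so [fwd] is unchanged along its whole
    orbit. *)
Lemma conn_off_saddle u v :
  ~~ conn D p u -> ~~ conn D p' u -> conn D' u v = conn D u v.
Proof.
move=> npu np'u; have sym := conn_sym oD.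
have cut_off w : conn D u w -> (cut1 != w) && (cut2 != w).
  move=> uw; rewrite /cut1 /cut2.
  have E r : conn D r u = conn D r w by apply: (same_connect_r sym).
  rewrite !E in npu np'u.
  have off r : ~~ conn D r w -> (r != w) && (dn D r != w) && (up D r != w).
    move=> rw; rewrite -andbA; apply/and3P; split; apply: contraNneq rw => <-.
    - exact: conn_refl.
    - exact: conn_dn.
    - exact: conn_up.
  move: (off _ npu) (off _ np'u) => /andP[/andP[pw _] qw] /andP[/andP[p'w q'w] _].
  by case: (o p); apply/andP.
have iterE i : iter i (fwd D') u = iter i (fwd D) u.
  elim: i => //= i ->; rewrite fwd_saddle.
  have /cut_off /andP[c1 c2] : conn D u (iter i (fwd D) u).
    by rewrite conn_fconnect // fconnect_iter.
  by rewrite tpermD.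
rewrite (conn_fconnect _ _ oD) (conn_fconnect _ _ oriented_saddle).
apply/idP/idP => /iter_findex <-.
  by rewrite iterE fconnect_iter.
by rewrite -iterE fconnect_iter.
Qed.

(** The new circles through the cut points form a set [S] closed under the old [fwd]: old and new
    successors differ only by exchanging those of the two cut points. As [S] contains [p] and [p'],
    it contains their old circles. *)
Lemma conn_on_saddle u :
  conn D p u || conn D p' u -> conn D' p u || conn D' q u.
Proof.
have sym := conn_sym oD; have sym' := conn_sym oriented_saddle.
pose S w := conn D' cut1 w || conn D' cut2 w.
have fc w : conn D' w (fwd D' w).
  by rewrite (conn_fconnect _ _ oriented_saddle) fconnect1.
have Sfwd w : S w -> S (fwd D w).
  have tS : S (fwd D' w) -> S w -> S (fwd D w).
    rewrite fwd_saddle; case: tpermP => // -> _ _.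
      by rewrite -[cut1](tpermR cut1 cut2) -fwd_saddle /S fc ?orbT.
    by rewrite -[X in fwd D X](tpermL cut1 cut2) -fwd_saddle /S fc ?orbT.
  move=> Sw; apply: tS => //; move: Sw; rewrite /S !(conn_fconnect _ _ oriented_saddle).
  by rewrite -!same_fconnect1_r //; exact/can_inj/oriented_saddle.
have Sconn w u0 : S w -> conn D w u0 -> S u0.
  by rewrite conn_fconnect // => Sw /iter_findex <-; elim: (findex _ _ _) => //= i; exact: Sfwd.
have S1 : S cut1 by rewrite /S conn_refl.
have S2 : S cut2 by rewrite /S conn_refl orbT.
have Sp : S p.
  case op : (o p); first by move: S1; rewrite /cut1 op.
  by apply: Sconn S2 _; rewrite /cut2 op /conn sym; exact: conn_up.
have Sp' : S p'.
  case op : (o p); last by move: S1; rewrite /cut1 op.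
  by apply: Sconn S2 _; rewrite /cut2 op /conn sym; exact: conn_dn.
move=> pu; have : S u by case/orP: pu; apply: Sconn.
rewrite /S /cut1 /cut2 /conn; case: (o p).
  by rewrite (same_connect sym' conn_saddle_q).
by rewrite (same_connect sym' conn_saddle_p).
Qed.

End Saddle.
End Oriented.

(** * Tensor powers of the algebra, as modules over a polynomial ring *)

Lemma basis_eltE (T : finType) (t s : T) : basis_elt t s = (s == t)%:Z.
Proof. by rewrite ffunE. Qed.

Lemma basis_decomp (T : finType) (x : {ffun T -> int}) : x = \sum_t basis_elt t *~ x t.
Proof.
apply/ffunP => s; rewrite sum_ffunE (bigD1 s) //= big1 ?addr0 => [|t nts].
  by rewrite ffunMzE basis_eltE eqxx intz.
by rewrite ffunMzE basis_eltE eq_sym (negPf nts) mul0rz.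
Qed.

Section Subtractive.
Variables (A B : zmodType) (phi psi : A -> B).
Hypotheses (phiB : {morph phi : x y / x - y}) (psiB : {morph psi : x y / x - y}).

Lemma subm0 : phi 0 = 0.
Proof. by rewrite -(subrr 0) phiB subrr. Qed.

Lemma submD : {morph phi : x y / x + y}.
Proof. by move=> x y; rewrite -[y in LHS]opprK -(sub0r y) !phiB subm0 sub0r opprK. Qed.

Lemma submM k : {morph phi : x / x *~ k}.
Proof.
have phiN x : phi (- x) = - phi x by rewrite -sub0r phiB subm0 sub0r.
have phin n x : phi (x *+ n) = phi x *+ n.
  by elim: n => [|n IH]; rewrite ?mulr0n ?subm0 // !mulrS submD IH.
by move=> x; case: k => n; rewrite ?NegzE ?mulrNz ?phiN phin.
Qed.

Lemma subm_sum I (r : seq I) (P : pred I) (E : I -> A) :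
  phi (\sum_(i <- r | P i) E i) = \sum_(i <- r | P i) phi (E i).
Proof. exact: (big_morph phi submD subm0). Qed.
End Subtractive.

Lemma subm_ext (T : finType) (B : zmodType) (phi psi : {ffun T -> int} -> B) :
  {morph phi : x y / x - y} -> {morph psi : x y / x - y} ->
  (forall t, phi (basis_elt t) = psi (basis_elt t)) -> phi =1 psi.
Proof.
move=> phiB psiB E x; rewrite [x]basis_decomp !subm_sum //.
by apply: eq_bigr => t _; rewrite !submM // E.
Qed.

Section Tensor.
Variable K : finType.
Local Notation lab := {ffun K -> bool}.
Local Notation tensor := {ffun lab -> int}.
Implicit Types (C : K) (x y : tensor) (f g : lab).

Definition relabel f C b : lab := [ffun C' => if C' == C then b else f C'].

Lemma relabelE f C b C' : relabel f C b C' = if C' == C then b else f C'.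
Proof. by rewrite ffunE. Qed.

(** Multiplication by X in the factor [C], read off coefficientwise: since X 1 = X and X X = 0, a
    label X of [g] at [C] comes from a label 1, and a label 1 comes from nothing. *)
Definition mulX C x : tensor := [ffun g : lab => if g C then x (relabel g C false) else 0].

Lemma mulXE C x g : mulX C x g = if g C then x (relabel g C false) else 0.
Proof. by rewrite ffunE. Qed.

Lemma mulXB C : {morph mulX C : x y / x - y}.
Proof. by move=> x y; apply/ffunP => g; rewrite !ffunE; case: ifP => _; rewrite ?subr0 // !ffunE. Qed.

Lemma mulXC C C' x : mulX C (mulX C' x) = mulX C' (mulX C x).
Proof.
apply/ffunP => g; rewrite !mulXE !relabelE.
have [->|ne] := eqVneq C C'; first by [].
case: (g C); case: (g C') => //.
congr (x _); apply/ffunP => C''; rewrite !relabelE.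
by case: ifP; case: ifP.
Qed.

Lemma mulX_basis C f :
  mulX C (basis_elt f) = if f C then 0 else basis_elt (relabel f C true).
Proof.
apply/ffunP => g; rewrite mulXE basis_eltE; case fv: (f C).
  rewrite ffunE; case: ifP => // _; case: eqP => // E.
  by move: fv; rewrite -E relabelE eqxx.
rewrite basis_eltE; case gv: (g C); last first.
  by case: eqP => // E; move: gv; rewrite E relabelE eqxx.
congr (Posz _); congr nat_of_bool; apply/eqP/eqP => [<-|->];
  apply/ffunP => C'; rewrite !relabelE; by case: eqP => // ->.
Qed.

Definition tensor1 : tensor := basis_elt [ffun=> false].

(** Cyclicity as an induction principle. Subtraction generates the additive structure, and a basis
    labeling is reached from the unit by one factor [mulX] per label X, whence the induction on the
    number of these labels. *)
Lemma tensor_ind (P : tensor -> Prop) :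
  P tensor1 -> (forall x y, P x -> P y -> P (x - y)) ->
  (forall C x, P x -> P (mulX C x)) -> forall x, P x.
Proof.
move=> P1 PB PX x.
have P0 : P 0 by rewrite -(subrr tensor1); apply: PB.
have PN y : P y -> P (- y) by move=> Py; rewrite -sub0r; apply: PB.
have PD y z : P y -> P z -> P (y + z).
  by move=> Py Pz; rewrite -[z]opprK; apply: PB => //; apply: PN.
have PM y (k : int) : P y -> P (y *~ k).
  have Pn n : P y -> P (y *+ n) by move=> Py; elim: n => [|n IH]; rewrite ?mulr0n // mulrS; apply: PD.
  by move=> Py; case: k => n; [|apply: PN]; apply: Pn.
rewrite [x]basis_decomp; apply: (big_ind P) => // f _; apply: PM; move: f.
suff Pn n f : #|[pred C | f C]| = n -> P (basis_elt f) by move=> f; apply: Pn.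
elim: n f => [|n IH] f cf.
  suff -> : f = [ffun=> false] by [].
  by apply/ffunP => C; rewrite ffunE; have := card0_eq cf C.
have /card_gt0P[C fC] : (0 < #|[pred C | f C]|)%N by rewrite cf.
rewrite inE in fC.
have -> : basis_elt f = mulX C (basis_elt (relabel f C false)).
  rewrite mulX_basis relabelE eqxx; congr basis_elt.
  by apply/ffunP => C'; rewrite !relabelE; case: eqP => // ->.
apply/PX/IH/eqP; rewrite -eqSS -cf (cardD1 C [pred C | f C]) inE fC add1n eqSS.
apply/eqP/eq_card => C'; rewrite !inE relabelE.
by case: eqP.
Qed.
End Tensor.

Section SaddleTensor.
Variables (V K K' : finType) (c : V -> K) (c' : V -> K') (p p' q : V).
Hypothesis cq : c q = c p.
Hypothesis off : forall u v, c u != c p -> c u != c p' -> (c' u == c' v) = (c u == c v).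
Hypothesis on : forall u, (c u == c p) || (c u == c p') -> (c' u == c' p) || (c' u == c' q).
Hypothesis split : (c' p == c' q) = (c p != c p').
Hypothesis surj' : forall C', exists v, c' v == C'.
Local Notation lab := {ffun K -> bool}.
Local Notation lab' := {ffun K' -> bool}.
Implicit Types (f : lab) (g : lab').

Definition same_outside f g :=
  [forall v, (c v != c p) && (c v != c p') ==> (g (c' v) == f (c v))].

(** This is [F_saddle_basis] with the circles replaced by elements of abstract types, to which it
    specializes by conversion. The algebra depends only on which points share a circle before and
    after the saddle, as listed in the hypotheses of the section. *)
Definition saddle_coef f g : int :=
  if same_outside f g then
    if c p != c p' then mulA (f (c p)) (f (c p')) (g (c' p))
    else DeltaA (f (c p)) (g (c' p), g (c' q))
  else 0.

Definition saddle_map (x : {ffun lab -> int}) : {ffun lab' -> int} :=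
  \sum_f [ffun g => saddle_coef f g] *~ x f.

Lemma saddle_mapB : {morph saddle_map : x y / x - y}.
Proof. by move=> x y; rewrite -sumrB; apply: eq_bigr => f _; rewrite !ffunE mulrzBr. Qed.

Lemma saddle_map_basis f : saddle_map (basis_elt f) = [ffun g => saddle_coef f g].
Proof.
rewrite /saddle_map (bigD1 f) //= big1 ?addr0 => [|g /negPf ng].
  by rewrite basis_eltE eqxx.
by rewrite basis_eltE ng mulr0z.
Qed.

Let mulAE a b d : mulA a b d = (~~ (a && b) && (d == a || b))%:Z.
Proof. by case: a b d => [] [] []; rewrite /mulA ffunE. Qed.

Let DeltaAE a b d : DeltaA a (b, d) = ((b || d) && (b && d == a))%:Z.
Proof. by case: a b d => [] [] []; rewrite /DeltaA !ffunE. Qed.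

Let off_neq u C : c u != c p -> c u != c p' -> (C == c' p) || (C == c' q) -> (c' u == C) = false.
Proof. by move=> pu p'u /orP[]/eqP->; rewrite off ?cq // (negPf pu). Qed.

Let outside_relabel f g C : (C == c' p) || (C == c' q) ->
  same_outside f (relabel g C false) = same_outside f g.
Proof.
move=> CE; apply: eq_forallb => v; rewrite !ffunE.
by case: (boolP (_ && _)) => //= /andP[pv p'v]; rewrite off_neq.
Qed.

Let outside_all_false g : g (c' p) = false -> g (c' q) = false ->
  (g == [ffun=> false]) = same_outside [ffun=> false] g.
Proof.
move=> gp gq; apply/eqP/forallP => [-> v|out]; first by rewrite !ffunE implybT.
apply/ffunP => C'; have [v /eqP <-] := surj' C'; have := out v; rewrite !ffunE.
rewrite -negb_or.
by case: (boolP (_ || _)) => [/on/orP[]/eqP -> _|_ /eqP ->].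
Qed.

Let nonzero C' g : g C' -> (g == [ffun=> false]) = false.
Proof. by move=> gC; apply/eqP => g0; rewrite g0 ffunE in gC. Qed.

(** A merge uses m(1, 1) = 1, a split Delta(1), whose two terms carry the label X on the circle of
    [p] and on that of [q] respectively. *)
Lemma saddle_map_tensor1 :
  saddle_map (tensor1 K) =
    if c p == c p' then mulX (c' p) (tensor1 K') + mulX (c' q) (tensor1 K')
    else tensor1 K'.
Proof.
rewrite saddle_map_basis; apply/ffunP => g.
rewrite ffunE /saddle_coef mulAE DeltaAE !ffunE.
have [E|ne] := eqVneq (c p) (c p') => /=.
  have npq : (c' p == c' q) = false by rewrite split E eqxx.
  have nqp : (c' q == c' p) = false by rewrite eq_sym npq.
  rewrite ffunE !mulXE !basis_eltE.
  case gp: (g (c' p)); case gq: (g (c' q)) => /=.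
  - rewrite if_same (nonzero (C' := c' q)) ?(nonzero (C' := c' p)) // relabelE ?npq //.
    by rewrite nqp.
  - rewrite outside_all_false ?relabelE ?eqxx ?nqp // outside_relabel ?eqxx // addr0.
    by case: ifP.
  - rewrite outside_all_false ?relabelE ?eqxx ?npq // outside_relabel ?eqxx ?orbT // add0r.
    by case: ifP.
  - by rewrite if_same.
have pq : c' p = c' q by apply/eqP; rewrite split ne.
rewrite basis_eltE; case gp: (g (c' p)) => /=.
  by rewrite if_same (nonzero (C' := c' p)).
by rewrite outside_all_false -?pq //; case: ifP.
Qed.

(** Away from the saddle labels are just carried along. On the circles involved this is A-linearity
    of the product and of the coproduct; in a split the factor X may be moved to either new
    circle. *)
Lemma saddle_mapX v x : saddle_map (mulX (c v) x) = mulX (c' v) (saddle_map x).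
Proof.
apply: (subm_ext (phi := fun x => saddle_map (mulX (c v) x))
                 (psi := fun x => mulX (c' v) (saddle_map x))) x.
- by move=> x y; rewrite mulXB saddle_mapB.
- by move=> x y; rewrite saddle_mapB mulXB.
move=> f; rewrite mulX_basis saddle_map_basis; apply/ffunP => g; rewrite mulXE ffunE.
transitivity (if f (c v) then 0 else saddle_coef (relabel f (c v) true) g).
  case: (f (c v)); last by rewrite saddle_map_basis ffunE.
  by rewrite (subm0 saddle_mapB) ffunE.
rewrite /saddle_coef.
have [in_v|out_v] := boolP ((c v == c p) || (c v == c p')).
  rewrite outside_relabel ?on //.
  have -> : same_outside (relabel f (c v) true) g = same_outside f g.
    apply: eq_forallb => u; rewrite !ffunE.
    case: (boolP (_ && _)) => //= /andP[pu p'u].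
    have /negPf -> // : c u != c v.
    by apply: contraTneq in_v => <-; rewrite negb_or pu.
  case: (same_outside f g); last by case: (f (c v)); case: (g (c' v)).
  rewrite !relabelE !mulAE !DeltaAE.
  have in_v' := on in_v.
  have [E|ne] := eqVneq (c p) (c p') => /=.
    have npq : (c' p == c' q) = false by rewrite split E eqxx.
    have nqp : (c' q == c' p) = false by rewrite eq_sym npq.
    have -> : c v = c p by move: in_v; rewrite -E orbb => /eqP.
    rewrite eqxx; case/orP: in_v' => /eqP ->; rewrite eqxx ?npq ?nqp.
      by case: (f (c p)); case: (g (c' p)); case: (g (c' q)).
    by case: (f (c p)); case: (g (c' p)); case: (g (c' q)).
  have pq : c' p = c' q by apply/eqP; rewrite split ne.
  have -> : c' v = c' p by move: in_v'; rewrite -pq orbb => /eqP.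
  rewrite eqxx; case/orP: in_v => /eqP ->; rewrite eqxx ?(negPf ne) ?[c p' == c p]eq_sym ?(negPf ne).
    by case: (f (c p)); case: (f (c p')); case: (g (c' p)).
  by case: (f (c p)); case: (f (c p')); case: (g (c' p)).
rewrite negb_or in out_v; case/andP: (out_v) => pv p'v.
have vp : (c' v == c' p) = false by rewrite off_neq ?eqxx.
have vq : (c' v == c' q) = false by rewrite off_neq ?eqxx ?orbT.
rewrite !relabelE (eq_sym (c p) (c v)) (eq_sym (c p') (c v)) (eq_sym (c' p) (c' v)) (eq_sym (c' q) (c' v)).
rewrite (negPf pv) (negPf p'v) vp vq; set val := if c p != c p' then _ else _.
(* The local factor [val] is common to both sides, so only the conditions for a nonzero coefficient
   remain: [f] has 1 at [v], [g] has X there, and the other outer labels agree. *)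
suff : ~~ f (c v) && same_outside (relabel f (c v) true) g =
       g (c' v) && same_outside f (relabel g (c' v) false).
  by case: (f (c v)); case: (g (c' v)); do 2 case: (same_outside _ _).
apply/andP/andP => -[fv /forallP out].
  have := out v; rewrite out_v relabelE eqxx => /eqP gv; split; first by rewrite gv.
  apply/forallP => u; apply/implyP => /andP[pu p'u]; have := out u.
  rewrite pu p'u !relabelE off //=; have [-> _|//] := eqVneq (c u) (c v).
  by rewrite eq_sym eqbF_neg.
have := out v; rewrite out_v relabelE eqxx => /eqP <-; split=> //.
apply/forallP => u; apply/implyP => /andP[pu p'u]; have := out u.
rewrite pu p'u !relabelE off //=; have [E _|//] := eqVneq (c u) (c v).
by rewrite eqb_id; have /eqP -> : c' u == c' v by rewrite off // E.
Qed.
End SaddleTensor.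

(** * The action on F(D), and equivariance of saddles *)

HB.instance Definition _ (V : finType) (D : curve V) := GRing.Zmodule.on (F D).

Fact action_key : unit. Proof. by []. Qed.

Section Action.
Variables (V : finType) (D : curve V).
Implicit Types (u v : V) (w : seq (V * V)) (x y : F D).

Definition circles : finType := circle D.

(* Locked because unfolding it makes failing unifications very slow. *)
Definition actX : V -> F D -> F D :=
  locked_with action_key (fun v => mulX (circle_of D v : circles)).

Lemma actXE v x : actX v x = mulX (circle_of D v : circles) x.
Proof. by rewrite /actX unlock. Qed.

Definition F1 : F D := tensor1 circles.

Lemma actXB v : {morph actX v : x y / x - y}.
Proof. by move=> x y; rewrite !actXE; apply: mulXB. Qed.

Lemma actXD v : {morph actX v : x y / x + y}.
Proof. exact: submD (actXB v). Qed.

Lemma actXC u v x : actX u (actX v x) = actX v (actX u x).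
Proof. by rewrite !actXE; apply: mulXC. Qed.

Lemma F_ind (P : F D -> Prop) :
  P F1 -> (forall x y, P x -> P y -> P (x - y)) ->
  (forall v x, P x -> P (actX v x)) -> forall x, P x.
Proof.
move=> P1 PB PX; apply: tensor_ind => // C x Px.
by have := PX (repr C) x Px; rewrite actXE reprK.
Qed.

(* A list w of pairs of marked points acts as the product of the factors
   X_u + X_v, for (u, v) in w. *)
Definition actS (uv : V * V) x : F D := actX uv.1 x + actX uv.2 x.
Definition actL w x : F D := foldr actS x w.

Lemma actL_cat w1 w2 x : actL (w1 ++ w2) x = actL w1 (actL w2 x).
Proof. exact: foldr_cat. Qed.

Lemma actXS v uv x : actX v (actS uv x) = actS uv (actX v x).
Proof. by rewrite /actS actXD ![actX v (actX _ _)]actXC. Qed.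

Lemma actXL v w x : actX v (actL w x) = actL w (actX v x).
Proof. by elim: w => //= uv w IH; rewrite actXS IH. Qed.

Lemma actLD w : {morph actL w : x y / x + y}.
Proof. by move=> x y; elim: w => //= uv w ->; rewrite /actS !actXD addrACA. Qed.

Lemma actLC w1 w2 x : actL w1 (actL w2 x) = actL w2 (actL w1 x).
Proof. by elim: w1 => //= uv w1 ->; rewrite /actS actLD !actXL. Qed.
End Action.

Lemma actX_conn (V : finType) (o : pred V) (D : curve V) u v (x : F D) :
  oriented o D -> conn D u v -> actX u x = actX v x.
Proof. by move=> oD; rewrite -(circle_of_eq _ _ oD) !actXE => /eqP ->. Qed.

(* phi is linear over the polynomial ring in the variables X_v, which acts on
   the target through h. *)
Definition equivariant (V V' : finType) (D : curve V) (D' : curve V')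
    (h : V -> V') (phi : F D -> F D') :=
  {morph phi : x y / x - y} /\ forall v, {morph phi : x / actX v x >-> actX (h v) x}.

Definition map2 (V V' : Type) (h : V -> V') (w : seq (V * V)) :=
  [seq (h uv.1, h uv.2) | uv <- w].

Lemma equivariantL (V V' : finType) (D : curve V) (D' : curve V') (h : V -> V')
    (phi : F D -> F D') w x :
  equivariant h phi -> phi (actL w x) = actL (map2 h w) (phi x).
Proof.
by move=> [phiB phiX]; elim: w => //= uv w <-; rewrite /actS (submD phiB) !phiX.
Qed.

Lemma equivariant_comp (V V' V'' : finType) (D : curve V) (D' : curve V') (D'' : curve V'')
    (h : V -> V') (h' : V' -> V'') (phi : F D -> F D') (psi : F D' -> F D'') :
  equivariant h phi -> equivariant h' psi -> equivariant (h' \o h) (psi \o phi).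
Proof. by move=> [pB pX] [qB qX]; split=> [x y|v x] /=; rewrite ?pB ?qB ?pX ?qX. Qed.

Section SaddleAction.
Variables (V : finType) (o : pred V) (D : curve V) (p p' : V).
Hypotheses (oD : oriented o D) (legD : legit o D (p, p')).
Local Notation q := (up D p).
Local Notation D' := (saddle D p p').

Let oD' : oriented o D' := oriented_saddle oD legD.
Let c (v : V) : circles D := circle_of D v.
Let c' (v : V) : circles D' := circle_of D' v.
Let cE u v : (c u == c v) = conn D u v. Proof. exact: (circle_of_eq _ _ oD). Qed.
Let cE' u v : (c' u == c' v) = conn D' u v. Proof. exact: (circle_of_eq _ _ oD'). Qed.

Let cq : c q = c p. Proof. by apply/eqP; rewrite eq_sym cE conn_up. Qed.
Let off u v : c u != c p -> c u != c p' -> (c' u == c' v) = (c u == c v).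
Proof.
rewrite !cE !cE' (connC u p oD) (connC u p' oD); exact: conn_off_saddle.
Qed.
Let on u : (c u == c p) || (c u == c p') -> (c' u == c' p) || (c' u == c' q).
Proof.
rewrite !cE !cE' !(connC u _ oD) !(connC u _ oD'); exact: conn_on_saddle.
Qed.
Let split : (c' p == c' q) = (c p != c p').
Proof. rewrite cE cE'; exact: conn_split. Qed.
Let surj' (C' : circles D') : exists v, c' v == C'. Proof. exact: circleP. Qed.

Lemma equivariant_saddle : equivariant id (F_saddle (D := D) p p').
Proof.
split=> [x y|v x]; first exact: (saddle_mapB c c' p p' q).
rewrite !actXE; exact: (saddle_mapX cq off on split).
Qed.

Definition step := if conn D p p' then [:: (p, q)] else [::].

Lemma F_saddle1 : F_saddle p p' (F1 D) = actL step (F1 D').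
Proof.
have -> : actL step (F1 D') = if c p == c p' then actX p (F1 D') + actX q (F1 D') else F1 D'.
  by rewrite cE /step; case: conn.
rewrite !actXE; exact: (saddle_map_tensor1 cq off on split surj').
Qed.
End SaddleAction.

(** * Subdivisions and disjoint unions *)

Section IsoTensor.
Variables (V V' K K' : finType) (c : V -> K) (c' : V' -> K') (h : V' -> V) (k : V -> V').
Hypothesis surj : forall C, exists v, c v == C.
Hypothesis surj' : forall C', exists v, c' v == C'.
Hypothesis ck : forall u v, c u = c v -> c' (k u) = c' (k v).
Hypothesis ch : forall u v, c' u = c' v -> c (h u) = c (h v).
Hypothesis hk : forall v, c (h (k v)) = c v.
Hypothesis kh : forall v, c' (k (h v)) = c' v.
Local Notation lab := {ffun K -> bool}.
Local Notation lab' := {ffun K' -> bool}.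

Definition iso_map (x : {ffun lab -> int}) : {ffun lab' -> int} :=
  [ffun g : lab' => \sum_(f : lab | [forall v, f (c (h v)) == g (c' v)]) x f].

Let pull (g : lab') : lab := [ffun C => g (c' (k (xchoose (surj C))))].

Let pullE g v : pull g (c v) = g (c' (k v)).
Proof. by rewrite ffunE; congr (g _); apply: ck; apply/eqP/(xchooseP (surj (c v))). Qed.

(** Since [h] and [k] are inverse to each other on circles, [g] forces every label of [f], and the
    sum in [iso_map] has exactly one term. *)
Let agree_pull (f : lab) (g : lab') : [forall v, f (c (h v)) == g (c' v)] = (f == pull g).
Proof.
apply/forallP/eqP => [E|-> v]; last by rewrite pullE kh.
apply/ffunP => C; have [v /eqP <-] := surj C.
by rewrite pullE -(eqP (E _)) hk.
Qed.

Let iso_mapE x g : iso_map x g = x (pull g).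
Proof. by rewrite ffunE (eq_bigl _ _ (fun f => agree_pull f g)) big_pred1_eq. Qed.

Lemma iso_mapB : {morph iso_map : x y / x - y}.
Proof. by move=> x y; apply/ffunP => g; rewrite !(iso_mapE, ffunE). Qed.

Lemma iso_map1 : iso_map (tensor1 K) = tensor1 K'.
Proof.
apply/ffunP => g; rewrite iso_mapE !basis_eltE; congr (Posz _); congr nat_of_bool.
apply/eqP/eqP => [E|->]; apply/ffunP => C.
  by have [v /eqP <-] := surj' C; rewrite -kh -pullE E !ffunE.
by rewrite !ffunE.
Qed.

Lemma iso_mapX v x : iso_map (mulX (c v) x) = mulX (c' (k v)) (iso_map x).
Proof.
apply/ffunP => g; rewrite mulXE !iso_mapE mulXE pullE; case: ifP => // _.
congr (x _); apply/ffunP => C; have [u /eqP <-] := surj C.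
rewrite relabelE !pullE relabelE.
have -> // : (c u == c v) = (c' (k u) == c' (k v)).
by apply/eqP/eqP => [/ck|/ch] //; rewrite !hk.
Qed.
End IsoTensor.

Section TensorTensor.
Variables (V1 V2 K1 K2 K : finType) (c1 : V1 -> K1) (c2 : V2 -> K2) (c : V1 + V2 -> K).
Hypothesis surj1 : forall C, exists v, c1 v == C.
Hypothesis surj2 : forall C, exists v, c2 v == C.
Hypothesis surj : forall C, exists v, c v == C.
Hypothesis cl : forall u v, (c (inl u) == c (inl v)) = (c1 u == c1 v).
Hypothesis cr : forall u v, (c (inr u) == c (inr v)) = (c2 u == c2 v).
Hypothesis clr : forall u v, (c (inl u) == c (inr v)) = false.
Local Notation lab1 := {ffun K1 -> bool}.
Local Notation lab2 := {ffun K2 -> bool}.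
Local Notation lab := {ffun K -> bool}.

Definition tensor_map (x : {ffun lab1 -> int}) (y : {ffun lab2 -> int}) : {ffun lab -> int} :=
  [ffun f : lab => \sum_(g1 : lab1 | [forall v, f (c (inl v)) == g1 (c1 v)])
                   \sum_(g2 : lab2 | [forall v, f (c (inr v)) == g2 (c2 v)]) x g1 * y g2].

Let res1 (f : lab) : lab1 := [ffun C => f (c (inl (xchoose (surj1 C))))].
Let res2 (f : lab) : lab2 := [ffun C => f (c (inr (xchoose (surj2 C))))].

Let res1E f v : res1 f (c1 v) = f (c (inl v)).
Proof.
rewrite ffunE; congr (f _); apply/eqP; rewrite cl; exact: (xchooseP (surj1 (c1 v))).
Qed.

Let res2E f v : res2 f (c2 v) = f (c (inr v)).
Proof.
rewrite ffunE; congr (f _); apply/eqP; rewrite cr; exact: (xchooseP (surj2 (c2 v))).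
Qed.

Let agree1 (f : lab) (g : lab1) : [forall v, f (c (inl v)) == g (c1 v)] = (g == res1 f).
Proof.
apply/forallP/eqP => [E|-> v]; last by rewrite res1E.
by apply/ffunP => C; have [v /eqP <-] := surj1 C; rewrite res1E; apply/esym/eqP.
Qed.

Let agree2 (f : lab) (g : lab2) : [forall v, f (c (inr v)) == g (c2 v)] = (g == res2 f).
Proof.
apply/forallP/eqP => [E|-> v]; last by rewrite res2E.
by apply/ffunP => C; have [v /eqP <-] := surj2 C; rewrite res2E; apply/esym/eqP.
Qed.

Let tensor_mapE x y f : tensor_map x y f = x (res1 f) * y (res2 f).
Proof.
rewrite ffunE (eq_bigl _ _ (agree1 f)) big_pred1_eq.
by rewrite (eq_bigl _ _ (agree2 f)) big_pred1_eq.
Qed.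

Lemma tensor_mapBl y : {morph tensor_map^~ y : x1 x2 / x1 - x2}.
Proof. by move=> x1 x2; apply/ffunP => f; rewrite !(tensor_mapE, ffunE) mulrBl. Qed.

Lemma tensor_mapBr x : {morph tensor_map x : y1 y2 / y1 - y2}.
Proof. by move=> y1 y2; apply/ffunP => f; rewrite !(tensor_mapE, ffunE) mulrBr. Qed.

Lemma tensor_map1 : tensor_map (tensor1 K1) (tensor1 K2) = tensor1 K.
Proof.
apply/ffunP => f; rewrite tensor_mapE !basis_eltE -PoszM mulnb.
congr (Posz _); congr nat_of_bool; apply/andP/eqP => [[/eqP E1 /eqP E2]|->].
  apply/ffunP => C; have [[v|v] /eqP <-] := surj C.
    by rewrite -res1E E1 !ffunE.
  by rewrite -res2E E2 !ffunE.
by split; apply/eqP/ffunP => C; rewrite !ffunE.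
Qed.

Lemma tensor_mapXl v x y : tensor_map (mulX (c1 v) x) y = mulX (c (inl v)) (tensor_map x y).
Proof.
apply/ffunP => f; rewrite mulXE !tensor_mapE mulXE res1E; case: ifP; rewrite ?mul0r // => _.
congr (x _ * y _); apply/ffunP => C.
  by have [u /eqP <-] := surj1 C; rewrite relabelE !res1E relabelE cl.
by have [u /eqP <-] := surj2 C; rewrite !res2E relabelE eq_sym clr.
Qed.

Lemma tensor_mapXr v x y : tensor_map x (mulX (c2 v) y) = mulX (c (inr v)) (tensor_map x y).
Proof.
apply/ffunP => f; rewrite mulXE !tensor_mapE mulXE res2E; case: ifP; rewrite ?mulr0 // => _.
congr (x _ * y _); apply/ffunP => C.
  by have [u /eqP <-] := surj1 C; rewrite !res1E relabelE clr.
by have [u /eqP <-] := surj2 C; rewrite relabelE !res2E relabelE cr.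
Qed.
End TensorTensor.

Lemma conn_map (V V' : finType) (D : curve V) (D' : curve V') (k : V -> V') :
  (forall v, conn D' (k v) (k (dn D v)) /\ conn D' (k v) (k (up D v))) ->
  forall u v, conn D u v -> conn D' (k u) (k v).
Proof.
move=> kP u v /connectP[s + ->]; elim: s u => [u _|w s IH u /= /andP[uw ws]].
  exact: conn_refl.
apply: (connect_trans _ (IH _ ws)); have [cd cu] := kP u.
by case/orP: uw => /eqP <-.
Qed.

(** The image of [h] is closed under both arcs at each of its points, hence a union of components of
    [D], and a path starting in it never leaves. *)
Lemma conn_embed (V V' : finType) (D : curve V) (D' : curve V') (h : V' -> V) u w :
  (forall v, dn D (h v) = h (dn D' v)) -> (forall v, up D (h v) = h (up D' v)) ->
  conn D (h u) w -> exists2 v, w = h v & conn D' u v.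
Proof.
move=> hd hu /connectP[s + ->]; elim: s u => [|a s IH] u /=.
  by exists u => //; apply: conn_refl.
case/andP => ua sa; have [b ab ub] : exists2 b, a = h b & conn D' u b.
  case/orP: ua => /eqP <-.
    by exists (dn D' u); [rewrite hd | apply: conn_dn].
  by exists (up D' u); [rewrite hu | apply: conn_up].
rewrite ab in sa *; have [v -> bv] := IH _ sa.
by exists v => //; apply: connect_trans ub bv.
Qed.

Lemma conn_embedE (V V' : finType) (D : curve V) (D' : curve V') (h : V' -> V) u v :
  injective h ->
  (forall v, dn D (h v) = h (dn D' v)) -> (forall v, up D (h v) = h (up D' v)) ->
  conn D (h u) (h v) = conn D' u v.
Proof.
move=> h_inj hd hu; apply/idP/idP => [/(conn_embed hd hu)[w /h_inj ->] //|].
by apply: conn_map => w; rewrite -hd -hu; split; [apply: conn_dn | apply: conn_up].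
Qed.

(* D and D' are subdivisions of the same 1-manifold, each marked point of one of
   them being identified with some point of the same circle of the other one. *)
Record subdivision (V V' : finType) (D : curve V) (D' : curve V')
    (h : V' -> V) (k : V -> V') : Prop := Subdivision {
  sub_k : forall v, conn D' (k v) (k (dn D v)) /\ conn D' (k v) (k (up D v));
  sub_h : forall v, conn D (h v) (h (dn D' v)) /\ conn D (h v) (h (up D' v));
  sub_hk : forall v, conn D (h (k v)) v;
  sub_kh : forall v, conn D' (k (h v)) v }.

Section Iso.
Variables (V V' : finType) (o : pred V) (o' : pred V') (D : curve V) (D' : curve V').
Variables (h : V' -> V) (k : V -> V').
Hypotheses (oD : oriented o D) (oD' : oriented o' D') (DD' : subdivision D D' h k).

Lemma conn_subdivision u v : conn D' (k u) (k v) = conn D u v.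
Proof.
apply/idP/idP; last exact: conn_map (sub_k DD') u v.
move/(conn_map (sub_h DD')) => huv.
have hkC w : conn D w (h (k w)) by rewrite (connC _ _ oD) (sub_hk DD').
exact: connect_trans (hkC u) (connect_trans huv (sub_hk DD' v)).
Qed.

Let c (v : V) : circles D := circle_of D v.
Let c' (v : V') : circles D' := circle_of D' v.
Let cP u v : c u = c v <-> conn D u v.
Proof. by rewrite -(circle_of_eq _ _ oD); split => /eqP. Qed.
Let cP' u v : c' u = c' v <-> conn D' u v.
Proof. by rewrite -(circle_of_eq _ _ oD'); split => /eqP. Qed.
Let surj (C : circles D) : exists v, c v == C. Proof. exact: circleP. Qed.
Let surj' (C : circles D') : exists v, c' v == C. Proof. exact: circleP. Qed.
Let ck u v : c u = c v -> c' (k u) = c' (k v).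
Proof. by rewrite cP cP' conn_subdivision. Qed.
Let ch u v : c' u = c' v -> c (h u) = c (h v).
Proof. rewrite cP cP'; exact: conn_map (sub_h DD') u v. Qed.
Let hk v : c (h (k v)) = c v. Proof. apply/cP; exact: (sub_hk DD'). Qed.
Let kh v : c' (k (h v)) = c' v. Proof. apply/cP'; exact: (sub_kh DD'). Qed.

Lemma equivariant_iso : equivariant k (F_iso h D' (D := D)).
Proof.
split=> [x y|v x]; first exact: (iso_mapB surj ck hk kh).
rewrite !actXE; exact: (iso_mapX surj ck ch hk kh).
Qed.

Lemma F_iso1 : F_iso h D' (F1 D) = F1 D'.
Proof. exact: (iso_map1 surj surj' ck hk kh). Qed.

Lemma card_circle_subdivision : #|{: circle D}| = #|{: circle D'}|.
Proof.
pose a (C : circles D) : circles D' := c' (k (repr C)).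
pose b (C : circles D') : circles D := c (h (repr C)).
apply: (bij_eq_card (f := a)); exists b => C; rewrite /a /b.
  by rewrite -[RHS]reprK -/(c _) -[RHS]hk; apply: ch; rewrite /c' reprK.
by rewrite -[RHS]reprK -/(c' _) -[RHS]kh; apply: ck; rewrite /c reprK.
Qed.
End Iso.

Section DisjointUnion.
Variables (V1 V2 : finType) (o1 : pred V1) (o2 : pred V2) (D1 : curve V1) (D2 : curve V2).
Hypotheses (oD1 : oriented o1 D1) (oD2 : oriented o2 D2).
Local Notation D := (disjoint_union D1 D2).
Definition orient_sum (v : V1 + V2) := match v with inl u => o1 u | inr u => o2 u end.

Lemma oriented_disjoint_union : oriented orient_sum D.
Proof.
have fl v : fwd orient_sum D (inl v) = inl (fwd o1 D1 v) by rewrite /fwd /=; case: ifP.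
have fr v : fwd orient_sum D (inr v) = inr (fwd o2 D2 v) by rewrite /fwd /=; case: ifP.
have bl v : bwd orient_sum D (inl v) = inl (bwd o1 D1 v) by rewrite /bwd /=; case: ifP.
have br v : bwd orient_sum D (inr v) = inr (bwd o2 D2 v) by rewrite /bwd /=; case: ifP.
by case=> v; rewrite ?fl ?fr ?bl ?br ?oD1 ?oD2.
Qed.
Local Notation oD := oriented_disjoint_union.

Let inlD (v : V1) : dn D (inl v) = inl (dn D1 v). Proof. by []. Qed.
Let inlU (v : V1) : up D (inl v) = inl (up D1 v). Proof. by []. Qed.
Let inrD (v : V2) : dn D (inr v) = inr (dn D2 v). Proof. by []. Qed.
Let inrU (v : V2) : up D (inr v) = inr (up D2 v). Proof. by []. Qed.

Lemma conn_inl u v : conn D (inl u) (inl v) = conn D1 u v.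
Proof. exact: (conn_embedE _ _ inl_inj inlD inlU). Qed.

Lemma conn_inr u v : conn D (inr u) (inr v) = conn D2 u v.
Proof. exact: (conn_embedE _ _ inr_inj inrD inrU). Qed.

Lemma conn_inl_inr u v : conn D (inl u) (inr v) = false.
Proof. by apply/negP => /(conn_embed inlD inlU)[]. Qed.

Let c1 (v : V1) : circles D1 := circle_of D1 v.
Let c2 (v : V2) : circles D2 := circle_of D2 v.
Let c (v : V1 + V2) : circles D := circle_of D v.
Let cl u v : (c (inl u) == c (inl v)) = (c1 u == c1 v).
Proof. by rewrite (circle_of_eq _ _ oD1) -conn_inl; apply: (circle_of_eq _ _ oD). Qed.
Let cr u v : (c (inr u) == c (inr v)) = (c2 u == c2 v).
Proof. by rewrite (circle_of_eq _ _ oD2) -conn_inr; apply: (circle_of_eq _ _ oD). Qed.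
Let clr u v : (c (inl u) == c (inr v)) = false.
Proof. by rewrite -(conn_inl_inr u v); apply: (circle_of_eq _ _ oD). Qed.
Let surj1 (C : circles D1) : exists v, c1 v == C. Proof. exact: circleP. Qed.
Let surj2 (C : circles D2) : exists v, c2 v == C. Proof. exact: circleP. Qed.
Let surj (C : circles D) : exists v, c v == C. Proof. exact: circleP. Qed.

Lemma equivariant_tensorl y : equivariant inl ((F_tensor (D1 := D1) (D2 := D2))^~ y).
Proof.
split=> [x1 x2|v x]; first exact: (tensor_mapBl surj1 surj2 cl cr).
rewrite !actXE; exact: (tensor_mapXl surj1 surj2 cl cr clr).
Qed.

Lemma equivariant_tensorr x : equivariant inr (F_tensor (D1 := D1) (D2 := D2) x).
Proof.
split=> [y1 y2|v y]; first exact: (tensor_mapBr surj1 surj2 cl cr).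
rewrite !actXE; exact: (tensor_mapXr surj1 surj2 cl cr clr).
Qed.

Lemma F_tensor1 : F_tensor (F1 D1) (F1 D2) = F1 D.
Proof. exact: (tensor_map1 surj1 surj2 surj cl cr). Qed.

Lemma card_circle_disjoint_union :
  #|{: circle D}| = (#|{: circle D1}| + #|{: circle D2}|)%N.
Proof.
rewrite -card_sum.
pose a (C : circles D1 + circles D2) : circles D :=
  match C with inl C => c (inl (repr C)) | inr C => c (inr (repr C)) end.
have aE1 v : a (inl (c1 v)) = c (inl v) by apply/eqP; rewrite cl; apply/eqP/reprK.
have aE2 v : a (inr (c2 v)) = c (inr v) by apply/eqP; rewrite cr; apply/eqP/reprK.
pose b (C : circles D) : circles D1 + circles D2 :=
  match repr C with inl u => inl (c1 u) | inr u => inr (c2 u) end.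
have cK C : c (repr C) = C by apply: reprK.
apply/esym; apply: (bij_eq_card (f := a)); exists b => [[C|C]|C].
- have [v /eqP <-] := surj1 C; rewrite aE1 /b; have := cK (c (inl v)).
  by case: (repr _) => u /eqP; [rewrite cl => /eqP -> | rewrite eq_sym clr].
- have [v /eqP <-] := surj2 C; rewrite aE2 /b; have := cK (c (inr v)).
  by case: (repr _) => u /eqP; [rewrite clr | rewrite cr => /eqP ->].
- by rewrite /b; have := cK C; case: (repr C) => u <-.
Qed.
End DisjointUnion.

(** * Sequences of saddles *)

(** Here [a] counts the circles before two saddles, [b] and [c] those after one of them, [d] and [e]
    those after both. Equal final counts force equal numbers of merges in the two orders. *)
Lemma splits_of_counts (a b c d e : nat) (s1 s2 s1' s2' : bool) :
  (b + (~~ s1).*2 = a + 1 -> d + (~~ s2').*2 = b + 1 -> c + (~~ s2).*2 = a + 1 ->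
   e + (~~ s1').*2 = c + 1 -> d = e -> ~~ s1 + ~~ s2' = ~~ s2 + ~~ s1')%N.
Proof. by case: s1; case: s2; case: s1'; case: s2' => /=; lia. Qed.

(** Commuting saddles yield the same arcs only pointwise; this suffices, being a [subdivision] along
    the identity. *)
Definition same_arcs (V : finType) (D D' : curve V) := dn D =1 dn D' /\ up D =1 up D'.

Section SameArcs.
Variables (V : finType) (D D' : curve V).
Hypothesis E : same_arcs D D'.

Lemma same_arcs_sym : same_arcs D' D.
Proof. by split=> v; rewrite ?E.1 ?E.2. Qed.

Lemma same_arcs_saddle p p' : same_arcs (saddle D p p') (saddle D' p p').
Proof. by split=> v /=; rewrite ?E.1 ?E.2. Qed.

Lemma same_arcs_conn u v : conn D u v = conn D' u v.
Proof. by apply: eq_connect => a b; rewrite /arc /= E.1 E.2. Qed.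

Lemma same_arcs_oriented o : oriented o D -> oriented o D'.
Proof. by move=> oD v; move: (oD v); rewrite /fwd /bwd -!E.1 -!E.2. Qed.

Lemma same_arcs_subdivision : subdivision D D' id id.
Proof.
split=> v; rewrite -?same_arcs_conn ?E.1 ?E.2 ?conn_refl //.
- by split; [rewrite -E.1; apply: conn_dn | rewrite -E.2; apply: conn_up].
- by split; [rewrite -E.1; apply: conn_dn | rewrite -E.2; apply: conn_up].
Qed.
End SameArcs.

(** Equality is required only on the generator, where X_u and X_v coincide for points of one circle;
    the two words met in [stepC] may differ as polynomials. *)
Definition word_eq (V : finType) (D : curve V) (w w' : seq (V * V)) :=
  actL w (F1 D) = actL w' (F1 D).

Lemma map2_id (V : Type) (w : seq (V * V)) : map2 id w = w.
Proof. by rewrite /map2 -[RHS]map_id; apply: eq_map => -[]. Qed.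

Lemma word_eq_subdivision (V V' : finType) o o' (D : curve V) (D' : curve V') h k w w' :
  oriented o D -> oriented o' D' -> subdivision D D' h k ->
  word_eq D w w' -> word_eq D' (map2 k w) (map2 k w').
Proof.
move=> oD oD' S /(congr1 (F_iso h D')).
by rewrite !(equivariantL _ _ (equivariant_iso oD oD' S)) (F_iso1 oD oD' S).
Qed.

Lemma word_eq_same (V : finType) o (D D' : curve V) w w' :
  oriented o D -> same_arcs D D' -> word_eq D w w' -> word_eq D' w w'.
Proof.
move=> oD E; have oD' := same_arcs_oriented E oD.
move/(word_eq_subdivision oD oD' (same_arcs_subdivision E)).
by rewrite !map2_id.
Qed.

Section Saddles.
Variables (V : finType) (o : pred V).
Implicit Types (D : curve V) (m : V * V) (s t : seq (V * V)).

Fixpoint legits D s :=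
  if s is m :: s' then legit o D m && legits (saddle D m.1 m.2) s' else true.

(** The factors X_p + X_q of the splits, in order; merges contribute nothing. *)
Fixpoint theta D s :=
  if s is m :: s' then step D m.1 m.2 ++ theta (saddle D m.1 m.2) s' else [::].

Lemma legit_pair D m : legit o D m -> legit o D (m.1, m.2).
Proof. by case: m. Qed.
#[local] Hint Resolve legit_pair : core.

Lemma oriented_saddles D s : oriented o D -> legits D s -> oriented o (saddles D s).
Proof.
elim: s D => //= m s IH D oD /andP[lm ls].
by apply: IH => //; apply: oriented_saddle => //; apply: legit_pair.
Qed.

Lemma equivariant_saddles D s :
  oriented o D -> legits D s -> equivariant id (F_saddles s (D := D)).
Proof.
elim: s D => [|m s IH] D oD /=; first by split.
case/andP => /legit_pair lm ls.
have := equivariant_comp (equivariant_saddle oD lm) (IH _ (oriented_saddle oD lm) ls).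
exact.
Qed.

Lemma F_saddles1 D s :
  oriented o D -> legits D s ->
  F_saddles s (F1 D) = actL (theta D s) (F1 (saddles D s)).
Proof.
elim: s D => [|m s IH] D oD //= /andP[/legit_pair lm ls].
have oD' := oriented_saddle oD lm.
rewrite (F_saddle1 oD lm) (equivariantL _ _ (equivariant_saddles oD' ls)).
by rewrite map2_id IH // actL_cat.
Qed.

(** A split adds a circle and a merge removes one, and [theta] has one entry per split. *)
Lemma card_circle_saddles D s :
  oriented o D -> legits D s ->
  (#|{: circle (saddles D s)}| + size s = #|{: circle D}| + 2 * size (theta D s))%N.
Proof.
elim: s D => [|m s IH] D oD; first by rewrite /= !addn0.
move=> /= /andP[/legit_pair lm ls].
have oD' := oriented_saddle oD lm.
have := card_circle_saddle oD lm; have := IH _ oD' ls.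
rewrite size_cat /step; case: conn => /=; lia.
Qed.

Lemma same_arcs_saddles D D' s : same_arcs D D' -> same_arcs (saddles D s) (saddles D' s).
Proof. by elim: s D D' => //= m s IH D D' E; apply/IH/same_arcs_saddle. Qed.

Lemma same_arcs_step D D' p p' : same_arcs D D' -> step D p p' = step D' p p'.
Proof. by move=> E; rewrite /step (same_arcs_conn E) E.2. Qed.

Lemma same_arcs_theta D D' s : same_arcs D D' -> theta D s = theta D' s.
Proof.
elim: s D D' => //= m s IH D D' E.
by rewrite (same_arcs_step _ _ E) (IH _ _ (same_arcs_saddle E _ _)).
Qed.

Lemma word_eq_saddles D s w w' :
  oriented o D -> legits D s -> word_eq D w w' ->
  word_eq (saddles D s) (w ++ theta D s) (w' ++ theta D s).
Proof.
move=> oD ls /(congr1 (F_saddles s (D := D))).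
rewrite !(equivariantL _ _ (equivariant_saddles oD ls)) !map2_id.
by rewrite F_saddles1 // -!actL_cat.
Qed.

(** Lower arcs are compared with lower ones and upper arcs with upper ones, because a saddle changes
    [up] only at the ends of its lower arc and [dn] only at the ends of its upper arc. Two apart
    saddles may thus share marked points, as happens in the middle row of [stack3]. *)
Definition apart D m m' :=
  [&& m'.1 != m.1, m'.1 != up D m.1, up D m'.1 != m.1 & up D m'.1 != up D m.1] &&
  [&& m'.2 != m.2, m'.2 != dn D m.2, dn D m'.2 != m.2 & dn D m'.2 != dn D m.2].

Lemma apart_sym D : symmetric (apart D).
Proof.
move=> m m'; rewrite /apart.
rewrite (eq_sym m'.1 m.1) (eq_sym m'.1 (up D m.1)) (eq_sym (up D m'.1) m.1)
        (eq_sym (up D m'.1) (up D m.1)) (eq_sym m'.2 m.2) (eq_sym m'.2 (dn D m.2))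
        (eq_sym (dn D m'.2) m.2) (eq_sym (dn D m'.2) (dn D m.2)).
by congr (_ && _); apply/and4P/and4P => -[*]; split.
Qed.

Lemma apart_up D m m' : apart D m m' -> up (saddle D m.1 m.2) m'.1 = up D m'.1.
Proof. by case/andP => /and4P[/negPf a /negPf b _ _] _; rewrite /= a b. Qed.

Lemma apart_dn D m m' : apart D m m' -> dn (saddle D m.1 m.2) m'.2 = dn D m'.2.
Proof. by case/andP => _ /and4P[/negPf a /negPf b _ _]; rewrite /= a b. Qed.

Lemma apart_legit D m m' :
  apart D m m' -> legit o (saddle D m.1 m.2) m' = legit o D m'.
Proof. by move=> a; rewrite /legit (apart_up a) (apart_dn a). Qed.

Definition independent D s := all (legit o D) s && pairwise (apart D) s.

Lemma independent_cons D m s :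
  independent D (m :: s) -> legit o D m /\ independent (saddle D m.1 m.2) s.
Proof.
case/andP => /= /andP[lm ls] /andP[/allP am as_]; split=> //; apply/andP; split.
  by apply/allP => m' ms; rewrite apart_legit ?am //; apply: (allP ls).
apply: (sub_in_pairwise (P := mem s)) as_; last by apply/allP.
move=> m1 m2 m1s m2s.
by rewrite /apart !(apart_up (am _ m1s), apart_up (am _ m2s), apart_dn (am _ m1s), apart_dn (am _ m2s)).
Qed.

Lemma independent_legits D s : independent D s -> legits D s.
Proof. by elim: s D => //= m s IH D /independent_cons[-> /IH ->]. Qed.

Lemma pairwise_perm (T : eqType) (r : rel T) (s t : seq T) :
  symmetric r -> perm_eq s t -> pairwise r s = pairwise r t.
Proof.
move=> rC; apply: (catCA_perm_subst (F := pairwise r)) => s1 s2 s3.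
have s21 : allrel r s2 s1 = allrel r s1 s2.
  by rewrite allrelC; apply: eq_allrel => x y; rewrite rC.
by rewrite !pairwise_cat !allrel_catr s21; do ![case: allrel | case: pairwise].
Qed.

Lemma independent_perm D s t : perm_eq s t -> independent D s = independent D t.
Proof.
move=> pst; congr (_ && _); first exact: perm_all.
exact: (pairwise_perm (@apart_sym D)).
Qed.

Section Commute.
Variables (D : curve V) (m1 m2 : V * V).
Hypotheses (oD : oriented o D) (l1 : legit o D m1) (l2 : legit o D m2).
Hypothesis a12 : apart D m1 m2.
Local Notation D1 := (saddle D m1.1 m1.2).
Local Notation D2 := (saddle D m2.1 m2.2).
Local Notation D12 := (saddle D1 m2.1 m2.2).
Local Notation D21 := (saddle D2 m1.1 m1.2).

Lemma saddleC : same_arcs D12 D21.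
Proof.
have a21 := a12; rewrite apart_sym in a21.
have [/and4P[/negPf a /negPf b /negPf c /negPf d] /and4P[/negPf a' /negPf b' /negPf c' /negPf d']] := andP a12.
have [/and4P[/negPf e /negPf f /negPf g /negPf h] /and4P[/negPf e' /negPf f' /negPf g' /negPf h']] := andP a21.
split=> v /=; rewrite ?a ?b ?c ?d ?a' ?b' ?c' ?d' ?e ?f ?g ?h ?e' ?f' ?g' ?h'.
  have [->|_] := eqVneq v m2.2; first by rewrite a' b'.
  by have [->|_] := eqVneq v (dn D m2.2); rewrite ?c' ?d'.
have [->|_] := eqVneq v m2.1; first by rewrite a b.
by have [->|_] := eqVneq v (up D m2.1); rewrite ?c ?d.
Qed.

Let oD1 : oriented o D1 := oriented_saddle oD (legit_pair l1).
Let oD2 : oriented o D2 := oriented_saddle oD (legit_pair l2).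
Let l21 : legit o D1 m2. Proof. by rewrite apart_legit. Qed.
Let l12 : legit o D2 m1. Proof. by rewrite apart_legit // apart_sym. Qed.
Let oD12 : oriented o D12 := oriented_saddle oD1 (legit_pair l21).

(* If the first saddle changes the type of the second one, then all the arcs
   involved come together, and both endpoints of the first one end up on the
   circles of the second one. *)
Lemma conn_type_change :
  conn D1 m2.1 m2.2 != conn D m2.1 m2.2 ->
  forall v, conn D1 m1.1 v || conn D1 (up D m1.1) v ->
  conn D12 m2.1 v || conn D12 (up D m2.1) v.
Proof.
move=> ne v; rewrite -(apart_up a12) => v1.
apply: conn_on_saddle; [exact: oD1 | exact: legit_pair | move: v1].
have lp1 := legit_pair l1; have sym := conn_sym oD; have sym1 := conn_sym oD1.
(* If the connection of [u] with [w] changes, then [u] lies on a circle that the first saddle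
   touches. *)
have near u w : conn D1 u w != conn D u w -> conn D m1.1 u || conn D m1.2 u.
  move=> uw; apply: contraR uw; rewrite negb_or => /andP[nu nu'].
  by rewrite (conn_off_saddle oD lp1 w nu nu').
have near1 := near _ _ ne.
have near2 : conn D m1.1 m2.2 || conn D m1.2 m2.2.
  by apply: (near _ m2.1); rewrite (connC _ _ oD) (connC _ _ oD1).
have on1 := conn_on_saddle oD lp1 near1; have on2 := conn_on_saddle oD lp1 near2.
have E u w z : conn D1 u w -> conn D1 w z = conn D1 u z.
  by move=> uw; rewrite /conn (same_connect sym1 uw).
(* If the first saddle is a merge, its result is a single circle, and [m2.1] lies on it. *)
have [c1|nc1] := boolP (conn D1 m1.1 (up D m1.1)).
  move: on1; rewrite !(E _ _ _ c1) !orbb => n1 v1.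
  by rewrite (E _ _ _ n1) v1.
(* Otherwise the first saddle splits a circle carrying both [m2.1] and [m2.2]. A change of type
   means that they land on different halves, so the second saddle meets both halves. *)
have cD : conn D m1.1 m1.2.
  by have := conn_split oD lp1; rewrite (negPf nc1) => /esym/negbFE.
have c2 : conn D m2.1 m2.2.
  move: near1 near2; rewrite /conn -!(same_connect sym cD) !orbb => n1 n2.
  by rewrite -(same_connect sym n1).
move: ne; rewrite c2 eqb_id => nc2.
case/orP: on1 => n1; case/orP: on2 => n2.
- by rewrite (E _ _ _ n1) n2 in nc2.
- by case/orP => v1; rewrite ?(E _ _ _ n1) ?(E _ _ _ n2) v1 ?orbT.
- by case/orP => v1; rewrite ?(E _ _ _ n1) ?(E _ _ _ n2) v1 ?orbT.
- by rewrite (E _ _ _ n1) n2 in nc2.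
Qed.

(** The counts give both orders the same number of splits. If the splits occur at the same saddles,
    the factors are the same; otherwise the two saddles interact, and the two different factors
    agree in the target. *)
Lemma stepC :
  word_eq D12 (step D m1.1 m1.2 ++ step D1 m2.1 m2.2)
              (step D m2.1 m2.2 ++ step D2 m1.1 m1.2).
Proof.
have lp1 := legit_pair l1; have lp2 := legit_pair l2.
have lp21 := legit_pair l21; have lp12 := legit_pair l12.
have count : (~~ conn D m1.1 m1.2 + ~~ conn D1 m2.1 m2.2 =
              ~~ conn D m2.1 m2.2 + ~~ conn D2 m1.1 m1.2)%N.
  apply: (splits_of_counts (card_circle_saddle oD lp1) (card_circle_saddle oD1 lp21)
    (card_circle_saddle oD lp2) (card_circle_saddle oD2 lp12)).
  exact: card_circle_subdivision oD12 (oriented_saddle oD2 lp12) (same_arcs_subdivision saddleC).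
have split1 : conn D12 m1.1 (up D m1.1) = ~~ conn D2 m1.1 m1.2.
  have a21 : apart D m2 m1 by rewrite apart_sym.
  by rewrite (same_arcs_conn saddleC) -(conn_split oD2 lp12) (apart_up a21).
have split2 : conn D12 m2.1 (up D m2.1) = ~~ conn D1 m2.1 m2.2.
  by rewrite -(conn_split oD1 lp21) (apart_up a12).
have sym := conn_sym oD12.
(* In the target each end of the arc of [m1] lies on the circle of an end of the arc of [m2]. By
   [split1] and [split2] either both pairs of ends are joined or both are separated, so the two sums
   run over the same circles. *)
have exchange : conn D1 m2.1 m2.2 != conn D m2.1 m2.2 ->
    conn D2 m1.1 m1.2 = conn D1 m2.1 m2.2 ->
    actS (m1.1, up D m1.1) (F1 D12) = actS (m2.1, up D m2.1) (F1 D12).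
  move=> /conn_type_change near same; rewrite /actS /=.
  have E u v := actX_conn (F1 D12) oD12 (u := u) (v := v).
  have C u w z : conn D12 u w -> conn D12 w z = conn D12 u z.
    by move=> uw; rewrite /conn (same_connect sym uw).
  have n1 : conn D12 m2.1 m1.1 || conn D12 (up D m2.1) m1.1.
    by apply: near; rewrite conn_refl.
  have n2 : conn D12 m2.1 (up D m1.1) || conn D12 (up D m2.1) (up D m1.1).
    by apply: near; rewrite conn_refl orbT.
  move: split1; rewrite same -split2.
  case/orP: n1 => n1; case/orP: n2 => n2; rewrite -(E _ _ n1) -(E _ _ n2) (C _ _ _ n1) ?n2.
  - by move/esym/E <-.
  - by [].
  - by rewrite addrC.
  - by move/esym/E <-.
have up2 := apart_up a12; have up1 : up D2 m1.1 = up D m1.1 by apply: apart_up; rewrite apart_sym.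
rewrite /word_eq /step up1 up2; move: count exchange.
(* The count leaves six patterns of types, in three of which the words coincide. The others are, for
   each order: two splits; a split followed by a merge; a merge followed by a split. *)
case: (conn D m1.1 _); case: (conn D1 _ _); case: (conn D m2.1 _); case: (conn D2 _ _) => //= _ ex.
- exact: (actLC [:: (m1.1, up D m1.1)] [:: (m2.1, up D m2.1)]).
- exact: (ex isT erefl).
- exact/esym/(ex isT erefl).
Qed.
End Commute.

Lemma word_eq_cat D w w1 w2 : word_eq D w1 w2 -> word_eq D (w ++ w1) (w ++ w2).
Proof. by rewrite /word_eq !actL_cat => ->. Qed.

Lemma same_arcs_trans D D' D'' : same_arcs D D' -> same_arcs D' D'' -> same_arcs D D''.
Proof. by move=> [d u] [d' u']; split=> v; rewrite ?d ?u. Qed.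

Definition saddles_eq D s t :=
  same_arcs (saddles D s) (saddles D t) /\ word_eq (saddles D s) (theta D s) (theta D t).

Lemma saddles_eq_trans D s t r :
  oriented o D -> legits D t ->
  saddles_eq D s t -> saddles_eq D t r -> saddles_eq D s r.
Proof.
move=> oD lt [E1 w1] [E2 w2]; split; first exact: same_arcs_trans E1 E2.
rewrite /word_eq w1; apply: (word_eq_same (oriented_saddles oD lt)) w2.
exact: same_arcs_sym.
Qed.

Lemma saddles_eq_cons D m s t :
  saddles_eq (saddle D m.1 m.2) s t -> saddles_eq D (m :: s) (m :: t).
Proof. by case=> E w; split=> //=; apply: word_eq_cat. Qed.

Lemma saddles_eq_swap D m m' s :
  oriented o D -> independent D [:: m, m' & s] ->
  saddles_eq D [:: m, m' & s] [:: m', m & s].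
Proof.
move=> oD ind; have /andP[/= /and3P[lm lm' _] /andP[/andP[am _] _]] := ind.
have E := saddleC am; split; first exact: (same_arcs_saddles s E).
rewrite /= -(same_arcs_theta s E) !catA.
have [_ ind1] := independent_cons ind; have [lm1 ind2] := independent_cons ind1.
have oD1 := oriented_saddle oD (legit_pair lm).
apply: (word_eq_saddles _ (independent_legits ind2)); last exact: stepC.
exact: oriented_saddle oD1 (legit_pair lm1).
Qed.

Lemma saddles_perm D s t :
  oriented o D -> independent D s -> perm_eq s t -> saddles_eq D s t.
Proof.
have refl D0 r : saddles_eq D0 r r by [].
(* Adjacent swaps carry the head past [t1]; the induction on [s] then rearranges the tail. *)
have move_head D0 m t1 t2 : oriented o D0 -> independent D0 (m :: t1 ++ t2) ->
    saddles_eq D0 (m :: t1 ++ t2) (t1 ++ m :: t2).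
  elim: t1 D0 => //= m' t1 IH D0 oD0 ind.
  have ind' : independent D0 [:: m', m & t1 ++ t2].
    by rewrite (independent_perm D0 (t := [:: m, m' & t1 ++ t2])) // (perm_catCA [:: m'] [:: m]).
  have [lm' ind1] := independent_cons ind'.
  apply: saddles_eq_trans (saddles_eq_swap oD0 ind) _ => //.
    exact: independent_legits.
  by apply/saddles_eq_cons/IH => //; apply: oriented_saddle oD0 (legit_pair lm').
elim: s D t => [|m s IH] D t oD ind pst.
  by rewrite perm_sym in pst; rewrite (perm_nilP pst).
have mt : m \in t by rewrite -(perm_mem pst) mem_head.
have [t1 [t2 tE]] : exists t1 t2, t = t1 ++ m :: t2.
  by case/splitPr: mt => t1 t2; exists t1, t2.
rewrite tE in pst *.
have ps : perm_eq s (t1 ++ t2).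
  by rewrite -(perm_cons m); apply: perm_trans pst _; rewrite (perm_catCA t1 [:: m] t2).
have [lm ind1] := independent_cons ind.
have ind2 : independent D (m :: t1 ++ t2).
  by rewrite -(independent_perm D (s := m :: s)) // perm_cons.
apply: saddles_eq_trans (move_head _ _ _ _ oD ind2) => //; first exact: independent_legits.
by apply/saddles_eq_cons/IH => //; apply: oriented_saddle oD (legit_pair lm).
Qed.

End Saddles.

Section SaddlesArcs.
Variables (V : finType) (o : pred V).
Implicit Types (D : curve V) (m : V * V) (s t : seq (V * V)).

Lemma saddles_cat D s t : saddles D (s ++ t) = saddles (saddles D s) t.
Proof. exact: foldl_cat. Qed.

Lemma theta_cat D s t : theta D (s ++ t) = theta D s ++ theta (saddles D s) t.
Proof. by elim: s D => //= m s IH D; rewrite IH catA. Qed.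

Lemma independent_apart D m s :
  independent o D (m :: s) -> forall m', m' \in s -> apart D m m'.
Proof. by case/andP => _ /= /andP[/allP]. Qed.

Lemma up_saddles_off D s v :
  independent o D s -> (forall m, m \in s -> (v != m.1) && (v != up D m.1)) ->
  up (saddles D s) v = up D v.
Proof.
elim: s D => //= m s IH D ind off; have [_ ind1] := independent_cons ind.
rewrite IH // => [|m' m's].
  by have /andP[/negPf v1 /negPf v2] := off m (mem_head _ _); rewrite /= v1 v2.
by rewrite (apart_up (independent_apart ind m's)) off // inE m's orbT.
Qed.

Lemma dn_saddles_off D s v :
  independent o D s -> (forall m, m \in s -> (v != m.2) && (v != dn D m.2)) ->
  dn (saddles D s) v = dn D v.
Proof.
elim: s D => //= m s IH D ind off; have [_ ind1] := independent_cons ind.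
rewrite IH // => [|m' m's].
  by have /andP[/negPf v1 /negPf v2] := off m (mem_head _ _); rewrite /= v1 v2.
by rewrite (apart_dn (independent_apart ind m's)) off // inE m's orbT.
Qed.

(** Later saddles are apart from [m], so the two arcs that [m] creates survive to the end. *)
Lemma arcs_saddles_in D s m :
  independent o D s -> m \in s ->
  [/\ up (saddles D s) m.1 = m.2, up (saddles D s) (up D m.1) = dn D m.2,
      dn (saddles D s) m.2 = m.1 & dn (saddles D s) (dn D m.2) = up D m.1].
Proof.
elim: s D => //= m0 s IH D ind; have [lm0 ind1] := independent_cons ind.
have am := independent_apart ind; rewrite inE => /orP[/eqP ->|ms]; last first.
  by have := IH _ ind1 ms; rewrite (apart_up (am _ ms)) (apart_dn (am _ ms)).
have /and3P[_ up0 dn0] := lm0.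
have upN : up D m0.1 == m0.1 = false by apply: contraNF up0 => /eqP ->.
have dnN : dn D m0.2 == m0.2 = false by apply: contraNF dn0 => /eqP ->.
split; rewrite ?(up_saddles_off ind1) ?(dn_saddles_off ind1) /= ?eqxx ?upN ?dnN //.
all: move=> m' m's; have a := am _ m's; have /= E := apart_up a; have /= E' := apart_dn a; rewrite ?E ?E'.
all: move: a; rewrite apart_sym => /andP[/and4P[e1 e2 e3 e4] /and4P[e5 e6 e7 e8]].
all: by rewrite ?e1 ?e2 ?e3 ?e4 ?e5 ?e6 ?e7 ?e8.
Qed.
End SaddlesArcs.

(** * Crossingless matchings *)

Section Matching.
Variable n : nat.
Implicit Types (a b c : matching n) (i j : 'I_(2 * n)).

Lemma matchingK b : involutive b.
Proof. by case: b => f /= /and3P[/forallP fK _ _] i; apply/eqP. Qed.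

Lemma matching_neq b i : b i != i.
Proof. by case: b => f /= /and3P[_ /forallP + _]. Qed.

Lemma matching_noncrossing b i j : ~~ [&& i < j, j < b i & b i < b j]%N.
Proof. by case: b => f /= /and3P[_ _ /forallP/(_ i)/forallP]. Qed.

(** The involution cuts [A] into pairs, and [r] selects one element of each pair. *)
Lemma card_involution (T : finType) (A : {set T}) (f : T -> T) (r : rel T) :
  {in A, forall x, f x \in A} -> {in A, involutive f} ->
  {in A, forall x, r (f x) x = ~~ r x (f x)} ->
  #|A| = #|[set x in A | r x (f x)]|.*2.
Proof.
move=> fA fK rf.
have inj : {in [set x in A | r x (f x)] &, injective f}.
  move=> x y; rewrite !inE => /andP[xA _] /andP[yA _] /(congr1 f).
  by rewrite !fK.
rewrite -addnn -{2}(card_in_imset inj) -(cardsID [set x in A | r x (f x)] A).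
congr (_ + _)%N; apply: eq_card => x; rewrite !inE.
  by case: (x \in A).
apply/idP/imsetP => [/andP[+ xA]|[y]].
  rewrite xA /= => nr; exists (f x); last by rewrite fK.
  by rewrite inE fA // fK // rf.
rewrite inE => /andP[yA ry] ->; rewrite fA // fK //= rf // ry; exact.
Qed.

(** Since arcs do not cross, the points strictly between [i] and [b i] are matched among themselves,
    so their number is even. *)
Lemma odd_matching b i : odd (b i) = ~~ odd i.
Proof.
wlog lt_i : i / (i < b i)%N.
  move=> IH; have := matching_neq b i; rewrite neq_ltn => /orP[|/IH //].
  by move=> lt; have := IH (b i); rewrite matchingK => /(_ lt) ->; rewrite negbK.
have between j : (i < j < b i)%N -> (i < b j < b i)%N.
  move=> /andP[ij jb]; have := matching_noncrossing b i j; rewrite ij jb /= -leqNgt => le.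
  have ne : b j != b i by apply: contraTneq ij => /(can_inj (matchingK b)) ->; rewrite ltnn.
  have ne' : b j != i by apply: contraTneq jb => <-; rewrite matchingK ltnn.
  have := matching_noncrossing b (b j) i; rewrite matchingK => nc.
  rewrite andbC ltn_neqAle ne le /=.
  by rewrite ltn_neqAle eq_sym ne' leqNgt; apply: contra nc => ->; rewrite ij jb.
have : ~~ odd #|[set j : 'I_(2 * n) | (i < j < b i)%N]|.
  rewrite (@card_involution _ _ b (fun i j => i < j)%N) ?odd_double // => j; rewrite ?inE.
  - exact: between.
  - by rewrite matchingK.
  - move=> _; rewrite -leqNgt ltn_neqAle.
    by have := matching_neq b j; rewrite -val_eqE /= => ->.
have -> : #|[set j : 'I_(2 * n) | (i < j < b i)%N]| = (b i - i.+1)%N.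
  rewrite cardsE -sum1_card -(big_mkord (fun j : nat => (i < j < b i)%N) (fun=> 1%N)).
  rewrite -[RHS]muln1 -sum_nat_const_nat (@big_nat_widenl _ _ _ i.+1 0) //.
  by rewrite (@big_nat_widen _ _ _ 0 (b i) (2 * n)) // ltnW.
by rewrite oddB // oddS; case: (odd i); case: (odd (b i)).
Qed.
Lemma card_left_ends b : #|[set i : 'I_(2 * n) | (i < b i)%N]| = n.
Proof.
have E : #|[set: 'I_(2 * n)]| = n.*2 by rewrite cardsT card_ord mul2n.
apply: double_inj; rewrite -E (@card_involution _ [set: _] b (fun i j => i < j)%N) => [|i _|i _|i _].
- by congr double; apply: eq_card => i; rewrite !inE.
- by rewrite inE.
- by rewrite matchingK.
- rewrite -leqNgt ltn_neqAle.
  by have := matching_neq b i; rewrite -val_eqE /= => ->.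
Qed.
End Matching.

(** * Bands along a matching *)

Section Band.
Variables (n : nat) (V : finType).
Local Notation I := 'I_(2 * n).
Implicit Types (b : matching n) (x y : I -> V) (r : seq I) (D : curve V).

Definition band x y r := [seq (x i, y i) | i <- r].

(* The strand x runs along the lower side of b, and y along its upper side. *)
Record along (o : pred V) D b x y : Prop := Along {
  along_xI : injective x;
  along_yI : injective y;
  along_up : forall i, up D (x i) = x (b i);
  along_dn : forall i, dn D (y i) = y (b i);
  along_ox : forall i, o (x i) = odd i;
  along_oy : forall i, o (y i) = odd i }.

Definition left_ends b r := uniq r && all (fun i : I => (i < b i)%N) r.

Definition touched b r i := (i \in r) || (b i \in r).

Lemma independent_band o D b x y r :
  along o D b x y -> left_ends b r -> independent o D (band x y r).
Proof.
move=> [xI yI upx dny ox oy] /andP[ru rb]; apply/andP; split.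
  apply/allP => _ /mapP[i _ ->].
  by rewrite /legit /= upx dny !ox !oy odd_matching eqxx; case: (odd i).
rewrite pairwise_map; move: ru; rewrite uniq_pairwise.
apply: sub_in_pairwise (rb) => i j.
rewrite -!topredE => ib jb /= ij; have {}ib : (i < b i)%N := ib; have {}jb : (j < b j)%N := jb.
have ji : j != i by rewrite eq_sym.
have jbi : j != b i.
  by apply: contraTneq jb => ->; rewrite matchingK -leqNgt ltnW.
have bji : b j != i by apply: contra_neq jbi => <-; rewrite matchingK.
have bjbi : b j != b i by rewrite (inj_eq (can_inj (@matchingK n b))).
by rewrite /apart /= !upx !dny !(inj_eq xI) !(inj_eq yI) ji jbi bji bjbi.
Qed.

Section State.
Variables (o : pred V) (D : curve V) (b : matching n) (x y : I -> V).
Variables (r : seq I) (s : seq (V * V)).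
Hypotheses (Db : along o D b x y) (ind : independent o D s).
Hypothesis s_in : forall i, i \in r -> (x i, y i) \in s.
Hypothesis s_out : forall m i, m \in s ->
  [|| m.1 == x i, up D m.1 == x i, m.2 == y i | dn D m.2 == y i] -> touched b r i.

Let touchedP i : touched b r i -> up (saddles D s) (x i) = y i /\ dn (saddles D s) (y i) = x i.
Proof.
have [xI yI upx dny ox oy] := Db; case/orP => /s_in/(arcs_saddles_in ind)[/=].
  by move=> -> _ -> _.
by rewrite upx dny matchingK => _ -> _ ->.
Qed.

(** The sequence [s] may contain saddles of another band, as it does in a stack of three; only those
    at the two strands of [b] affect these arcs. *)
Lemma up_band i : up (saddles D s) (x i) = if touched b r i then y i else x (b i).
Proof.
case: ifP => [/touchedP[] //|/negbT nt]; rewrite (up_saddles_off ind) ?(along_up Db) // => m ms.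
by rewrite -negb_or; apply: contra nt => H; apply: s_out ms _; rewrite ![_ == x i]eq_sym orbA H.
Qed.

Lemma dn_band i : dn (saddles D s) (y i) = if touched b r i then x i else y (b i).
Proof.
case: ifP => [/touchedP[] //|/negbT nt]; rewrite (dn_saddles_off ind) ?(along_dn Db) // => m ms.
by rewrite -negb_or; apply: contra nt => H; apply: s_out ms _; rewrite ![_ == y i]eq_sym H !orbT.
Qed.
End State.

End Band.

(** A word records only the type of each saddle at the moment it is performed, so it is enough to
    compare connectivity after every prefix of the band. *)
Lemma theta_band_eq n (V V' : finType) (o : pred V) (o' : pred V') (D : curve V) (D' : curve V')
    (k : V -> V') x y x' y' r :
  independent o D (band x y r) -> independent o' D' (band x' y' r) ->
  (forall i : 'I_(2 * n), k (x i) = x' i) ->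
  (forall i, i \in r -> k (up D (x i)) = up D' (x' i)) ->
  (forall r1 i r2, r = r1 ++ i :: r2 ->
     conn (saddles D (band x y r1)) (x i) (y i) = conn (saddles D' (band x' y' r1)) (x' i) (y' i)) ->
  map2 k (theta D (band x y r)) = theta D' (band x' y' r).
Proof.
move=> + + kx; elim: r D D' => //= i r IH D D' ind ind' ku kc.
have [_ ind1] := independent_cons ind; have [_ ind1'] := independent_cons ind'.
rewrite /map2 map_cat -/(map2 k _); congr (_ ++ _).
  rewrite /step (kc [::] i r) //=; case: ifP => //= _.
  by rewrite kx ku ?mem_head.
apply: IH => // [j jr|r1 j r2 rE]; last by apply: (kc (i :: r1) j r2); rewrite rE.
have a := independent_apart ind (map_f (fun i => (x i, y i)) jr).
have a' := independent_apart ind' (map_f (fun i => (x' i, y' i)) jr).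
have /= -> := apart_up a; have /= -> := apart_up a'.
by rewrite ku // inE jr orbT.
Qed.

(** Saddles inside a union of components never see the rest of the curve. *)
Lemma theta_embed (V V' : finType) (D : curve V) (D' : curve V') (h : V' -> V) s :
  injective h ->
  (forall v, dn D (h v) = h (dn D' v)) -> (forall v, up D (h v) = h (up D' v)) ->
  theta D (map2 h s) = map2 h (theta D' s).
Proof.
move=> hI; elim: s D D' => //= m s IH D D' hd hu.
rewrite /map2 map_cat -/(map2 h _); congr (_ ++ _).
  by rewrite /step (conn_embedE _ _ hI hd hu); case: ifP => //= _; rewrite hu.
apply: IH => v /=; rewrite !(hd, hu) !(inj_eq hI).
  by case: ifP => // _; case: ifP.
by case: ifP => // _; case: ifP.
Qed.

(** * Associativity and units *)

Section Two.
Variable n : nat.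
Local Notation I := 'I_(2 * n).
Implicit Types (a b c : matching n) (r : seq I).

Definition parity : pred I := fun i => odd i.

Lemma oriented_Wcat b a : oriented parity (Wcat b a).
Proof.
move=> i; rewrite /fwd /bwd /parity /=.
by case: (boolP (odd i)) => oi; rewrite odd_matching ?oi ?(negPf oi) /= matchingK.
Qed.

Definition stack2 c b a := disjoint_union (Wcat b a) (Wcat c b).
Definition parity2 := orient_sum parity parity.
Definition below2 (v : I + I) : I := match v with inl i => i | inr i => i end.
Definition bands2 r := band (inl : I -> I + I) inr r.

Lemma oriented_stack2 c b a : oriented parity2 (stack2 c b a).
Proof. exact: oriented_disjoint_union (oriented_Wcat b a) (oriented_Wcat c b). Qed.

Lemma along_stack2 c b a : along parity2 (stack2 c b a) b inl inr.
Proof. by split=> //; [apply: inl_inj | apply: inr_inj]. Qed.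

Section Bands.
Variables (c b a : matching n) (r : seq I).
Hypothesis rb : left_ends b r.
Local Notation D := (saddles (stack2 c b a) (bands2 r)).

Lemma independent_bands2 : independent parity2 (stack2 c b a) (bands2 r).
Proof. exact: independent_band (along_stack2 c b a) rb. Qed.

Lemma oriented_bands2 : oriented parity2 D.
Proof.
exact: oriented_saddles (oriented_stack2 c b a) (independent_legits independent_bands2).
Qed.

Lemma arcs_bands2 :
  [/\ forall i, dn D (inl i) = inl (a i),
      forall i, up D (inl i) = if touched b r i then inr i else inl (b i),
      forall i, dn D (inr i) = if touched b r i then inl i else inr (b i) &
      forall i, up D (inr i) = inr (c i)].
Proof.
have ind := independent_bands2.
have s_in i : i \in r -> (inl i, inr i) \in bands2 r by apply: map_f.
have s_out m i : m \in bands2 r ->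
   [|| m.1 == inl i, up (stack2 c b a) m.1 == inl i, m.2 == inr i
     | dn (stack2 c b a) m.2 == inr i] -> touched b r i.
  case/mapP => j jr -> /=; rewrite !(inj_eq inl_inj) !(inj_eq inr_inj) /touched.
  by case/or4P => /eqP <-; rewrite ?matchingK jr ?orbT.
split=> i.
- by rewrite (dn_saddles_off ind) // => _ /mapP[j _ ->].
- exact: (up_band (along_stack2 c b a) ind s_in s_out).
- exact: (dn_band (along_stack2 c b a) ind s_in s_out).
- by rewrite (up_saddles_off ind) // => _ /mapP[j _ ->].
Qed.
End Bands.

Lemma subdivision2 c b a r :
  left_ends b r -> (forall i, touched b r i) ->
  subdivision (saddles (stack2 c b a) (bands2 r)) (Wcat c a) inl below2.
Proof.
move=> rb rT; have [dnl upl dnr upr] := arcs_bands2 c a rb; set D := saddles _ _ in dnl upl dnr upr *.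
have oD : oriented parity2 D by apply: oriented_bands2.
have lr i : conn D (inl i) (inr i) by have := conn_up D (inl i); rewrite upl rT.
split=> [[i|i]|i|[i|i]|i] //=; rewrite ?dnl ?upl ?dnr ?upr ?rT /=; try exact: conn_refl.
- by split; [apply: (conn_dn (Wcat c a)) | apply: conn_refl].
- by split; [apply: conn_refl | apply: (conn_up (Wcat c a))].
- split; first by have := conn_dn D (inl i); rewrite dnl.
  apply: connect_trans (lr i) _; apply: (@connect_trans _ _ (inr (c i))).
    by have := conn_up D (inr i); rewrite upr.
  by rewrite (conn_sym oD); apply: lr.
Qed.
End Two.

(** * Three stacked diagrams: the curve of a threefold product *)

Section Three.
Variable n : nat.
Local Notation I := 'I_(2 * n).
Variables (d c b a : matching n).

Definition stack3 := disjoint_union (Wcat b a) (stack2 d c b).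
Definition parity3 := orient_sum (@parity n) (@parity2 n).
Definition mid : I -> I + (I + I) := inr \o inl.
Definition top : I -> I + (I + I) := inr \o inr.
Definition below3 (v : I + (I + I)) : I := match v with inl i => i | inr v => below2 v end.

Lemma oriented_stack3 : oriented parity3 stack3.
Proof. exact: oriented_disjoint_union (oriented_Wcat b a) (oriented_stack2 d c b). Qed.

Lemma mid_inj : injective mid. Proof. by move=> i j []. Qed.
Lemma top_inj : injective top. Proof. by move=> i j []. Qed.

Lemma along_low : along parity3 stack3 b inl mid.
Proof. by split=> //; [apply: inl_inj | apply: mid_inj]. Qed.

Lemma along_high : along parity3 stack3 c mid top.
Proof. by split=> //; [apply: mid_inj | apply: top_inj]. Qed.

Definition low_bands r := band (inl : I -> I + (I + I)) mid r.
Definition high_bands r := band mid top r.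

Section Bands.
Variables (r t : seq I).
Hypotheses (rb : left_ends b r) (tc : left_ends c t).

(** Both bands meet the middle row, but the low one cuts its lower arcs ([dn]) and the high one its
    upper arcs ([up]). *)
Lemma independent_low_high : independent parity3 stack3 (low_bands r ++ high_bands t).
Proof.
have /andP[rl rp] := independent_band along_low rb.
have /andP[tl tp] := independent_band along_high tc.
rewrite /independent all_cat rl tl /= pairwise_cat rp tp !andbT.
by apply/allrelP => _ _ /mapP[i _ ->] /mapP[j _ ->].
Qed.

Variable s : seq ((I + (I + I)) * (I + (I + I))).
Hypothesis sE : perm_eq s (low_bands r ++ high_bands t).
Local Notation D := (saddles stack3 s).

Lemma independent_bands3 : independent parity3 stack3 s.
Proof. by rewrite (independent_perm _ _ sE) independent_low_high. Qed.

Lemma oriented_bands3 : oriented parity3 D.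
Proof. exact: oriented_saddles oriented_stack3 (independent_legits independent_bands3). Qed.

Lemma arcs_bands3 :
  [/\ forall i, dn D (inl i) = inl (a i) /\
                up D (inl i) = if touched b r i then mid i else inl (b i),
      forall i, dn D (mid i) = if touched b r i then inl i else mid (b i),
      forall i, up D (mid i) = if touched c t i then top i else mid (c i) &
      forall i, dn D (top i) = (if touched c t i then mid i else top (c i)) /\
                up D (top i) = top (d i)].
Proof.
have ind := independent_bands3.
have low_in i : i \in r -> (inl i, mid i) \in s.
  by move=> ir; rewrite (perm_mem sE) mem_cat; apply/orP; left; apply: map_f.
have high_in i : i \in t -> (mid i, top i) \in s.
  by move=> it; rewrite (perm_mem sE) mem_cat; apply/orP; right; apply: map_f.
have low_out m i : m \in s ->
   [|| m.1 == inl i, up stack3 m.1 == inl i, m.2 == mid i | dn stack3 m.2 == mid i] ->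
   touched b r i.
  rewrite (perm_mem sE) mem_cat => /orP[] /mapP[j jr ->] //=.
  rewrite -!/(mid _) !(inj_eq inl_inj) !(inj_eq mid_inj) /touched.
  by case/or4P => /eqP <-; rewrite ?matchingK jr ?orbT.
have high_out m i : m \in s ->
   [|| m.1 == mid i, up stack3 m.1 == mid i, m.2 == top i | dn stack3 m.2 == top i] ->
   touched c t i.
  rewrite (perm_mem sE) mem_cat => /orP[] /mapP[j jr ->] //=.
  rewrite -!/(mid _) -!/(top _) !(inj_eq top_inj) !(inj_eq mid_inj) /touched.
  by case/or4P => /eqP <-; rewrite ?matchingK jr ?orbT.
split=> i; [split | | | split].
- rewrite (dn_saddles_off ind) // => m.
  by rewrite (perm_mem sE) mem_cat => /orP[] /mapP[j jr ->].
- exact: (up_band along_low ind low_in low_out).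
- exact: (dn_band along_low ind low_in low_out).
- exact: (up_band along_high ind high_in high_out).
- exact: (dn_band along_high ind high_in high_out).
- rewrite (up_saddles_off ind) // => m.
  by rewrite (perm_mem sE) mem_cat => /orP[] /mapP[j jr ->].
Qed.
End Bands.
End Three.

Lemma independent_catr (V : finType) (o : pred V) D (s t : seq (V * V)) :
  independent o D (s ++ t) -> independent o (saddles D s) t.
Proof. by elim: s D => //= m s IH D /independent_cons[_ /IH]. Qed.

Lemma map2_comp (U V W : Type) (f : V -> W) (g : U -> V) w :
  map2 f (map2 g w) = map2 (f \o g) w.
Proof. by rewrite /map2 -map_comp. Qed.

Lemma eq_map2 (V W : Type) (f g : V -> W) w : f =1 g -> map2 f w = map2 g w.
Proof. by move=> E; apply: eq_map => uv; rewrite !E. Qed.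

Lemma map2_cat (V W : Type) (f : V -> W) w w' : map2 f (w ++ w') = map2 f w ++ map2 f w'.
Proof. exact: map_cat. Qed.

Lemma left_ends_prefix n (b : matching n) r1 r2 : left_ends b (r1 ++ r2) -> left_ends b r1.
Proof. by rewrite /left_ends cat_uniq all_cat => /andP[/andP[-> _] /andP[-> _]]. Qed.

(** * Reducing a stack of three to stacks of two, and associativity of words *)

Section Collapse.
Variable n : nat.
Local Notation I := 'I_(2 * n).
Variables (d c b a : matching n) (sb sc : seq I).
Hypotheses (lb : left_ends b sb) (Tb : forall i, touched b sb i).
Hypotheses (lc : left_ends c sc) (Tc : forall i, touched c sc i).

Definition collapse_high (v : I + (I + I)) : I + I :=
  match v with inl i => inl i | inr v => inr (below2 v) end.
Definition expand_high (v : I + I) : I + (I + I) :=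
  match v with inl i => inl i | inr i => mid i end.
Definition collapse_low (v : I + (I + I)) : I + I :=
  match v with inl i => inl i | inr (inl i) => inl i | inr (inr i) => inr i end.
Definition expand_low (v : I + I) : I + (I + I) :=
  match v with inl i => inl i | inr i => top i end.

(** Once the c-saddles are done, [mid i] and [top i] are joined by a vertical segment, so the two
    upper rows act as one. The partial list [r] is there because [theta_band_eq] compares the curves
    before each b-saddle. *)
Lemma subdivision_high r : left_ends b r ->
  subdivision (saddles (stack3 d c b a) (high_bands sc ++ low_bands r))
              (saddles (stack2 d b a) (bands2 r)) expand_high collapse_high.
Proof.
move=> lr; have pE : perm_eq (high_bands sc ++ low_bands r) (low_bands r ++ high_bands sc).
  by rewrite perm_catC.
have oD := oriented_bands3 d a lr lc pE.
have [low dm um high] := arcs_bands3 d a lr lc pE; rewrite /mid /top /= in low dm um high.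
have [dnl upl dnr upr] := arcs_bands2 d a lr.
set D := saddles (stack3 _ _ _ _) _ in oD low dm um high *; set D' := saddles _ _ in dnl upl dnr upr *.
have mt i : conn D (inr (inl i)) (inr (inr i)).
  by have := conn_up D (inr (inl i)); rewrite um Tc.
split=> [[i|[i|i]]|[i|i]|[i|[i|i]]|[i|i]] //=; try exact: conn_refl; try exact: mt.
- have [-> ->] := low i; have := conn_dn D' (inl i); have := conn_up D' (inl i).
  by rewrite dnl upl; case: ifP.
- rewrite dm um Tc; split; last exact: conn_refl.
  by have := conn_dn D' (inr i); rewrite dnr; case: ifP.
- have [-> ->] := high i; rewrite Tc; split; first exact: conn_refl.
  by have := conn_up D' (inr i); rewrite upr.
- have [di ui] := low i; have := conn_dn D (inl i); have := conn_up D (inl i).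
  by rewrite di ui dnl upl; case: ifP.
- split.
    by have := conn_dn D (inr (inl i)); rewrite dm dnr; case: ifP.
  rewrite upr; apply: connect_trans (mt i) _; apply: (@connect_trans _ _ (inr (inr (d i)))).
    by have [_ ui] := high i; have := conn_up D (inr (inr i)); rewrite ui.
  by rewrite (conn_sym oD); apply: mt.
Qed.

(** Symmetrically, after the b-saddles the rows [inl] and [mid] act as one, and the high band
    becomes the band of [stack2 d c a]. *)
Lemma subdivision_low t : left_ends c t ->
  subdivision (saddles (stack3 d c b a) (low_bands sb ++ high_bands t))
              (saddles (stack2 d c a) (bands2 t)) expand_low collapse_low.
Proof.
move=> lt; have pE : perm_eq (low_bands sb ++ high_bands t) (low_bands sb ++ high_bands t) by [].
have oD := oriented_bands3 d a lb lt pE.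
have [low dm um high] := arcs_bands3 d a lb lt pE; rewrite /mid /top /= in low dm um high.
have [dnl upl dnr upr] := arcs_bands2 d a lt.
set D := saddles (stack3 _ _ _ _) _ in oD low dm um high *; set D' := saddles _ _ in dnl upl dnr upr *.
have lm i : conn D (inl i) (inr (inl i)).
  by have [_ ui] := low i; have := conn_up D (inl i); rewrite ui Tb.
split=> [[i|[i|i]]|[i|i]|[i|[i|i]]|[i|i]] //=; try exact: conn_refl; try exact: lm.
- have [-> ->] := low i; have := conn_dn D' (inl i).
  by rewrite dnl Tb; split=> //; apply: conn_refl.
- rewrite dm um Tb; split; first exact: conn_refl.
  by have := conn_up D' (inl i); rewrite upl; case: ifP.
- have [-> ->] := high i; have := conn_up D' (inr i); have := conn_dn D' (inr i).
  by rewrite upr dnr; case: ifP.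
- have [di ui] := low i; split; first by have := conn_dn D (inl i); rewrite di dnl.
  rewrite upl; apply: connect_trans (lm i) _.
  have := conn_up D (inr (inl i)); rewrite um; case: ifP => // _ mm.
  apply: connect_trans mm _.
  by rewrite (conn_sym oD); apply: lm.
- have [di ui] := high i; have cu := conn_up D (inr (inr i)); have cd := conn_dn D (inr (inr i)).
  split; last by rewrite upr; rewrite ui in cu.
  move: cd; rewrite di dnr; case: ifP => // _ mm; apply: connect_trans mm _.
  by rewrite (conn_sym oD); apply: lm.
Qed.

Lemma subdivision3 s : perm_eq s (low_bands sb ++ high_bands sc) ->
  subdivision (saddles (stack3 d c b a) s) (Wcat d a) inl (@below3 n).
Proof.
move=> pE; have oD := oriented_bands3 d a lb lc pE.
have [low dm um high] := arcs_bands3 d a lb lc pE; rewrite /mid /top /= in low dm um high.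
set D := saddles _ _ in oD low dm um high *.
have lm i : conn D (inl i) (inr (inl i)).
  by have [_ ui] := low i; have := conn_up D (inl i); rewrite ui Tb.
have mt i : conn D (inr (inl i)) (inr (inr i)).
  by have := conn_up D (inr (inl i)); rewrite um Tc.
have lt i : conn D (inl i) (inr (inr i)) by apply: connect_trans (lm i) (mt i).
split=> [[i|[i|i]]|i|[i|[i|i]]|i] //=; try exact: conn_refl; try exact: lm; try exact: lt.
- by have [-> ->] := low i; rewrite Tb; split; [apply: (conn_dn (Wcat d a)) | apply: conn_refl].
- by rewrite dm um Tb Tc; split; apply: conn_refl.
- by have [-> ->] := high i; rewrite Tc; split; [apply: conn_refl | apply: (conn_up (Wcat d a))].
- split; first by have [di _] := low i; have := conn_dn D (inl i); rewrite di.
  apply: connect_trans (lt i) _; apply: (@connect_trans _ _ (inr (inr (d i)))).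
    by have [_ ui] := high i; have := conn_up D (inr (inr i)); rewrite ui.
  by rewrite (conn_sym oD); apply: lt.
Qed.

Definition Theta c b a sb := map2 (@below2 n) (theta (stack2 c b a) (bands2 sb)).

(** The word of (xy)z: the c-saddles take place inside the component block [stack2 d c b], and the
    b-saddles then in a subdivision of [stack2 d b a]. *)
Lemma theta_high_low :
  map2 (@below3 n) (theta (stack3 d c b a) (high_bands sc ++ low_bands sb)) =
  Theta d c b sc ++ Theta d b a sb.
Proof.
have pE r : perm_eq (high_bands sc ++ low_bands r) (low_bands r ++ high_bands sc).
  by rewrite perm_catC.
have ind := independent_bands3 d a lb lc (pE _).
rewrite theta_cat map2_cat; congr (_ ++ _).
  have -> : high_bands sc = map2 inr (bands2 sc) by rewrite /map2 -map_comp.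
  by rewrite (theta_embed (D' := stack2 d c b)) //; [rewrite map2_comp | apply: inr_inj].
rewrite (eq_map2 _ (g := below2 (n := n) \o collapse_high)) => [|[i|[i|i]]] //.
rewrite -map2_comp; congr map2.
apply: (theta_band_eq (independent_catr ind) (independent_bands2 d a lb)) => [//|i _|r1 i r2 E].
  (* With an empty low band, [arcs_bands3] describes the curve just after the c-saddles, whose lower
     row still has its original arcs. *)
  have nil : left_ends b [::] by [].
  have [low _ _ _] := arcs_bands3 d a nil lc (pE [::]); rewrite cats0 in low.
  by have [_ ->] := low i.
have l1 : left_ends b r1 by apply: (@left_ends_prefix _ _ _ (i :: r2)); rewrite -E.
rewrite -saddles_cat; symmetry.
exact: (conn_subdivision (oriented_bands3 d a l1 lc (pE _)) (subdivision_high l1) (inl i) (mid i)).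
Qed.

(** The word of x(yz), with the blocks [stack2 c b a] and then [stack2 d c a]. *)
Lemma theta_low_high :
  map2 (@below3 n) (theta (stack3 d c b a) (low_bands sb ++ high_bands sc)) =
  Theta c b a sb ++ Theta d c a sc.
Proof.
have pE t : perm_eq (low_bands sb ++ high_bands t) (low_bands sb ++ high_bands t) by [].
have ind := independent_bands3 d a lb lc (pE _).
rewrite theta_cat map2_cat; congr (_ ++ _).
  pose h (v : I + I) : I + (I + I) := match v with inl i => inl i | inr i => mid i end.
  have -> : low_bands sb = map2 h (bands2 sb) by rewrite /map2 -map_comp.
  have hI : injective h by move=> [i|i] [j|j] // [->].
  rewrite (theta_embed (D' := stack2 c b a) _ hI) => [|[i|i]|[i|i]] //.
  by rewrite map2_comp; apply: eq_map2 => -[i|i].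
rewrite (eq_map2 _ (g := below2 (n := n) \o collapse_low)) => [|[i|[i|i]]] //.
rewrite -map2_comp; congr map2.
apply: (theta_band_eq (independent_catr ind) (independent_bands2 d a lc)) => [//|i _|r1 i r2 E].
  have nil : left_ends c [::] by [].
  have [_ _ um _] := arcs_bands3 d a lb nil (pE [::]); rewrite cats0 in um.
  by rewrite um.
have l1 : left_ends c r1 by apply: (@left_ends_prefix _ _ _ (i :: r2)); rewrite -E.
rewrite -saddles_cat; symmetry.
exact: (conn_subdivision (oriented_bands3 d a lb l1 (pE _)) (subdivision_low l1) (mid i) (top i)).
Qed.

Lemma Theta_assoc :
  word_eq (Wcat d a) (Theta d c b sc ++ Theta d b a sb) (Theta c b a sb ++ Theta d c a sc).
Proof.
have pE : perm_eq (high_bands sc ++ low_bands sb) (low_bands sb ++ high_bands sc).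
  by rewrite perm_catC.
rewrite -theta_high_low -theta_low_high.
apply: (word_eq_subdivision (oriented_bands3 d a lb lc pE) (oriented_Wcat d a) (subdivision3 pE)).
have [_ //] := saddles_perm (oriented_stack3 d c b a) (independent_bands3 d a lb lc pE) pE.
Qed.
End Collapse.

(** * The maps m_{c,b,a} and their associativity *)

Section Product.
Variables (n : nat) (s : matching n -> seq 'I_(2 * n)).
Hypothesis s_order : forall b, saddle_order b (s b).
Local Notation I := 'I_(2 * n).
Implicit Types (a b c d : matching n).

Lemma left_ends_order b : left_ends b (s b).
Proof.
have /perm_mem sE := s_order b; rewrite /left_ends (perm_uniq (s_order b)).
rewrite filter_uniq ?enum_uniq //=; apply/allP => i.
by rewrite sE mem_filter => /andP[].
Qed.

Lemma touched_order b i : touched b (s b) i.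
Proof.
have mE j : (j \in s b) = (j < b j)%N.
  by rewrite (perm_mem (s_order b)) mem_filter mem_enum andbT.
rewrite /touched !mE matchingK.
by have := matching_neq b i; rewrite eq_sym -val_eqE neq_ltn.
Qed.

Lemma size_order b : size (s b) = n.
Proof.
rewrite (perm_size (s_order b)) -[RHS](card_left_ends b) cardE.
by congr size; rewrite /enum_mem -filter_predI; apply: eq_filter => i; rewrite /= !inE andbT.
Qed.

Local Notation Th c b a := (Theta c b a (s b)).
Local Notation lo := left_ends_order.

(** The points [inl i] and [inr i] are joined by a vertical segment in the end, so X_i acting on
    either factor becomes X_i on the product. *)
Lemma mH_equiv_l c b a (y : F (Wcat b a)) :
  equivariant id (fun x : F (Wcat c b) => mH s x y).
Proof.
have oD := oriented_stack2 c b a.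
have := equivariant_comp (equivariant_comp
  (equivariant_tensorr (oriented_Wcat b a) (oriented_Wcat c b) y)
  (equivariant_saddles oD (independent_legits (independent_bands2 c a (lo b)))))
  (equivariant_iso (oriented_bands2 c a (lo b)) (oriented_Wcat c a)
     (subdivision2 c a (lo b) (touched_order b))).
exact.
Qed.

Lemma mH_equiv_r c b a (x : F (Wcat c b)) :
  equivariant id (fun y : F (Wcat b a) => mH s x y).
Proof.
have oD := oriented_stack2 c b a.
have := equivariant_comp (equivariant_comp
  (equivariant_tensorl (oriented_Wcat b a) (oriented_Wcat c b) x)
  (equivariant_saddles oD (independent_legits (independent_bands2 c a (lo b)))))
  (equivariant_iso (oriented_bands2 c a (lo b)) (oriented_Wcat c a)
     (subdivision2 c a (lo b) (touched_order b))).
exact.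
Qed.

Lemma mH1 c b a : mH s (F1 (Wcat c b)) (F1 (Wcat b a)) = actL (Th c b a) (F1 (Wcat c a)).
Proof.
have oD := oriented_stack2 c b a.
have oE := oriented_bands2 c a (lo b).
have S := subdivision2 c a (lo b) (touched_order b).
rewrite /mH (F_tensor1 (oriented_Wcat b a) (oriented_Wcat c b)).
rewrite (F_saddles1 oD (independent_legits (independent_bands2 c a (lo b)))).
rewrite (equivariantL _ _ (equivariant_iso oE (oriented_Wcat c a) S)).
by rewrite (F_iso1 oE (oriented_Wcat c a) S).
Qed.

(** Both sides are linear over the X_i in each of the three arguments, so [F_ind] reduces the claim
    to the three generators. *)
Lemma mHA d c b a (x : F (Wcat d c)) (y : F (Wcat c b)) (z : F (Wcat b a)) :
  mH s (mH s x y) z = mH s x (mH s y z).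
Proof.
have L a' b' c' y' := @mH_equiv_l c' b' a' y'.
have R a' b' c' x' := @mH_equiv_r c' b' a' x'.
move: x; apply: F_ind => [|x x' IH IH'|v x IH]; first last.
- by rewrite (L _ _ _ _).2 (L _ _ _ _).2 IH (L _ _ _ _).2.
- by rewrite (L _ _ _ _).1 (L _ _ _ _).1 IH IH' (L _ _ _ _).1.
move: y; apply: F_ind => [|y y' IH IH'|v y IH]; first last.
- by rewrite (R _ _ _ _).2 (L _ _ _ _).2 IH (L _ _ _ _).2 (R _ _ _ _).2.
- by rewrite (R _ _ _ _).1 (L _ _ _ _).1 IH IH' (L _ _ _ _).1 (R _ _ _ _).1.
move: z; apply: F_ind => [|z z' IH IH'|v z IH]; first last.
- by rewrite (R _ _ _ _).2 IH (R _ _ _ _).2 (R _ _ _ _).2.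
- by rewrite (R _ _ _ _).1 IH IH' (R _ _ _ _).1 (R _ _ _ _).1.
rewrite !mH1 (equivariantL _ _ (L _ _ _ _)) (equivariantL _ _ (R _ _ _ _)) !mH1 !map2_id.
rewrite -!actL_cat; exact: (Theta_assoc d a (lo b) (touched_order b) (lo c) (touched_order c)).
Qed.
End Product.

Lemma theta_nil (V : finType) (D : curve V) s :
  (forall s1 m s2, s = s1 ++ m :: s2 -> conn (saddles D s1) m.1 m.2 = false) ->
  theta D s = [::].
Proof.
elim: s D => //= m s IH D H; rewrite /step (H [::] m s) // IH // => s1 m' s2 E.
by rewrite (H (m :: s1) m' s2) // E.
Qed.

(** * Units, and circle counts for the grading *)

Section Units.
Variable n : nat.
Local Notation I := 'I_(2 * n).
Implicit Types (a b c : matching n).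

Lemma untouched b r1 i r2 : left_ends b (r1 ++ i :: r2) ->
  left_ends b r1 /\ touched b r1 i = false /\ touched b r1 (b i) = false.
Proof.
move=> lr; split; first exact: left_ends_prefix lr.
have /andP[] := lr; rewrite cat_uniq all_cat => /and3P[_ + _] /andP[/allP r1b /= /andP[ib _]].
rewrite /= negb_or => /andP[/negPf ir _]; rewrite /touched matchingK ir /= orbF.
suff -> : (b i \in r1) = false by [].
by apply/negP => /r1b; rewrite matchingK ltnNge ltnW.
Qed.

Lemma split_bands2 r s1 m s2 : bands2 r = s1 ++ m :: s2 ->
  exists r1 i r2, [/\ r = r1 ++ i :: r2, s1 = bands2 r1 & m = (inl i, inr i) :> (I + I) * (I + I)].
Proof.
elim: s1 r => [|m1 s1 IH] [|i r] //=.
  by case=> <- _; exists [::], i, r.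
by case=> <- /IH[r1 [j [r2 [-> -> ->]]]]; exists (i :: r1), j, r2.
Qed.

(** As long as the arc of [i] is uncut, [inl i] and [inl (a i)] form a circle of their own in the
    lower diagram, so the saddle at [i] is a merge. *)
Lemma Theta_unit_r c a r : left_ends a r -> Theta c a a r = [::].
Proof.
move=> lr; rewrite /Theta theta_nil // => s1 m s2 /split_bands2[r1 [i [r2 [rE -> ->]]]] /=.
rewrite rE in lr; have [l1 [ti tai]] := untouched lr.
have [dnl upl _ _] := arcs_bands2 c a l1.
(* The circle in question is the image of a two-point model whose [dn] and [up] both exchange the
   points. *)
pose h (e : bool) : I + I := inl (if e then a i else i).
apply/negP => /(@conn_embed _ _ _ (Curve negb negb) h false).
by case=> [[]|[]|] //= ; rewrite /h ?dnl ?upl ?ti ?tai ?matchingK.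
Qed.

Lemma Theta_unit_l c a r : left_ends c r -> Theta c c a r = [::].
Proof.
move=> lr; rewrite /Theta theta_nil // => s1 m s2 /split_bands2[r1 [i [r2 [rE -> ->]]]] /=.
rewrite rE in lr; have [l1 [ti tci]] := untouched lr.
have [_ _ dnr upr] := arcs_bands2 c a l1.
pose h (e : bool) : I + I := inr (if e then c i else i).
rewrite (connC _ _ (oriented_bands2 c a l1)).
apply/negP => /(@conn_embed _ _ _ (Curve negb negb) h false).
by case=> [[]|[]|] //= ; rewrite /h ?dnr ?upr ?ti ?tci ?matchingK.
Qed.

Variable s : matching n -> seq I.
Hypothesis s_order : forall b, saddle_order b (s b).
Local Notation lo := (left_ends_order s_order).

Lemma mH1r c a (x : F (Wcat c a)) : mH s x (F1 (Wcat a a)) = x.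
Proof.
have L := mH_equiv_l s_order c (F1 (Wcat a a)).
move: x; apply: F_ind => [|x x' IH IH'|v x IH].
- by rewrite (mH1 s_order) Theta_unit_r //; apply: lo.
- by rewrite L.1 IH IH'.
- by rewrite L.2 IH.
Qed.

Lemma mH1l c a (x : F (Wcat c a)) : mH s (F1 (Wcat c c)) x = x.
Proof.
have R := mH_equiv_r s_order a (F1 (Wcat c c)).
move: x; apply: F_ind => [|x x' IH IH'|v x IH].
- by rewrite (mH1 s_order) Theta_unit_l //; apply: lo.
- by rewrite R.1 IH IH'.
- by rewrite R.2 IH.
Qed.

Lemma card_circle_Wcat c b a :
  (#|{: circle (Wcat c a)}| + n =
   #|{: circle (Wcat b a)}| + #|{: circle (Wcat c b)}| + 2 * size (Theta c b a (s b)))%N.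
Proof.
have := card_circle_saddles (oriented_stack2 c b a) (independent_legits (independent_bands2 c a (lo b))).
rewrite (card_circle_disjoint_union (oriented_Wcat b a) (oriented_Wcat c b)).
rewrite (card_circle_subdivision (oriented_bands2 c a (lo b)) (oriented_Wcat c a)
  (subdivision2 c a (lo b) (touched_order s_order b))).
by rewrite !size_map (size_order s_order).
Qed.

(** With all three matchings equal and no splits, the count for products reads k + n = k + k. *)
Lemma card_circle_diag a : #|{: circle (Wcat a a)}| = n.
Proof.
have := card_circle_Wcat a a a; rewrite Theta_unit_r; last exact: lo.
by rewrite muln0 addn0 => /eqP; rewrite eqn_add2l => /eqP.
Qed.

(** Every circle contains the two distinct points [i] and [a i], and there are 2n points in all. *)
Lemma leq_card_circle b a : (#|{: circle (Wcat b a)}| <= n)%N.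
Proof.
have [oD bN] := (oriented_Wcat b a, matching_neq a).
pose g (Ce : circles (Wcat b a) * bool) : I := let i := repr Ce.1 in if Ce.2 then a i else i.
have gc Ce : circle_of (Wcat b a) (g Ce) = Ce.1.
  case: Ce => C [] /=; rewrite -[RHS]reprK /g //=.
  by apply/esym/eqP; rewrite (circle_of_eq _ _ oD); apply: (conn_dn (Wcat b a)).
have gI : injective g.
  move=> x y E; have E1 : x.1 = y.1 by rewrite -gc E gc.
  case: x y E1 E => [C e] [C' e'] /= <-; rewrite /g /=.
  by case: e e' => [] [] // /eqP; rewrite ?(negPf (bN _)) // eq_sym (negPf (bN _)).
have := leq_card g gI; rewrite card_prod card_bool card_ord mulnC.
by rewrite leq_pmul2l.
Qed.
End Units.

(** * Degrees *)

Section TensorDegree.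
Variable K : finType.
Local Notation lab := {ffun K -> bool}.
Implicit Types (f : lab) (x : {ffun lab -> int}).

Definition deg_lab f : int := \sum_C degA (f C).

Definition part (k : int) x : {ffun lab -> int} := [ffun f : lab => if deg_lab f == k then x f else 0].

Lemma partB k : {morph part k : x y / x - y}.
Proof. by move=> x y; apply/ffunP => f; rewrite !ffunE; case: ifP; rewrite ?subr0. Qed.

(** Replacing a label 1 by X raises the degree from -1 to 1, that is by 2. *)
Lemma part_mulX k C x : part k (mulX C x) = mulX C (part (k - 2) x).
Proof.
apply/ffunP => f; rewrite mulXE !ffunE; case fC: (f C); last by rewrite if_same.
suff -> : deg_lab f = deg_lab (relabel f C false) + 2.
  by rewrite [in RHS]eq_sym subr_eq [in RHS]eq_sym.
rewrite /deg_lab (bigD1 C) //= [in RHS](bigD1 C) //= relabelE eqxx fC.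
rewrite (eq_bigr (fun C' => degA (relabel f C false C'))) => [|C' /negPf ne].
  by rewrite /degA addrAC.
by rewrite relabelE ne.
Qed.

Lemma part_tensor1 k : part k (tensor1 K) = if - #|K|%:Z == k then tensor1 K else 0.
Proof.
have d0 : deg_lab [ffun=> false] = - #|K|%:Z.
  rewrite /deg_lab (eq_bigr (fun=> -1)) => [|C _]; last by rewrite ffunE.
  by rewrite sumr_const cardE -cardE mulNrn natz.
apply/ffunP => f; rewrite !ffunE; case: (eqVneq f [ffun=> false]) => [->|nf] /=.
  by rewrite d0; case: ifP; rewrite ffunE ?eqxx.
by rewrite if_same; case: ifP; rewrite ffunE ?(negPf nf).
Qed.
Lemma deg_lab_ge f : - #|K|%:Z <= deg_lab f.
Proof.
have -> : - #|K|%:Z = \sum_(C : K) -1 by rewrite sumr_const cardE -cardE mulNrn natz.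
by apply: ler_sum => C _; rewrite /degA; case: (f C).
Qed.
End TensorDegree.

Section Degree.
Variables (V : finType) (D : curve V).
Implicit Types (x y : F D) (k e : int).

Definition homF k x := forall f : labeling D, x f != 0 -> deg_labeling f = k.

Definition partF k x : F D := part (K := circles D) k x.

Lemma homF0 k : homF k 0.
Proof. by move=> f; rewrite ffunE eqxx. Qed.

Lemma homFB k x y : homF k x -> homF k y -> homF k (x - y).
Proof.
move=> hx hy f; rewrite !ffunE => nz; have [x0|/hx //] := eqVneq (x f) 0.
by apply: hy; apply: contraNneq nz => y0; rewrite x0 y0 subr0.
Qed.

Lemma homFD k x y : homF k x -> homF k y -> homF k (x + y).
Proof.
move=> hx hy; have -> : x + y = x - (0 - y) by rewrite sub0r opprK.
by apply: homFB => //; apply: homFB => //; apply: homF0.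
Qed.

Lemma partF_id k x : homF k x -> partF k x = x.
Proof.
move=> hx; apply/ffunP => f; rewrite ffunE; case: eqP => // ne.
by apply/esym/eqP/negPn/negP => /hx.
Qed.

Lemma homF_part k x : partF k x = x -> homF k x.
Proof. by move=> <- f; rewrite ffunE; case: ifP => [/eqP //|]; rewrite eqxx. Qed.

Lemma homF_actX k v x : homF k x -> homF (k + 2) (actX v x).
Proof.
move/partF_id => E; apply: homF_part; rewrite /partF actXE part_mulX addrK.
by congr mulX.
Qed.

Lemma homF_F1 : homF (- #|{: circle D}|%:Z) (F1 D).
Proof. by apply: homF_part; rewrite /partF /F1 part_tensor1 eqxx. Qed.

Lemma homF_actL k w x : homF k x -> homF (k + 2 * (size w)%:Z) (actL w x).
Proof.
move=> hx; elim: w => [|uv w IH] /=; first by rewrite mulr0 addr0.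
have -> : k + 2 * (size w).+1%:Z = k + 2 * (size w)%:Z + 2 by lia.
by apply: homFD; apply: homF_actX.
Qed.
End Degree.

(** Each X_v has degree 2 on both sides, so the degree of [phi] can be read off the generator.
    Elements met in [F_ind] need not be homogeneous; the induction therefore treats all homogeneous
    parts of an arbitrary element. *)
Lemma homF_equivariant (V V' : finType) (D : curve V) (D' : curve V') h (phi : F D -> F D') e k x :
  equivariant h phi -> homF (- #|{: circle D}|%:Z + e) (phi (F1 D)) ->
  homF k x -> homF (k + e) (phi x).
Proof.
move=> [phiB phiX] phi1 /partF_id <-; move: x k; apply: F_ind => [k|x y hx hy k|v x hx k].
- rewrite /partF part_tensor1; case: eqP => [<- //|_].
  by rewrite (subm0 phiB); apply: homF0.
- by rewrite /partF partB phiB; apply: homFB; [apply: hx | apply: hy].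
have -> : partF k (actX v x) = actX v (partF (k - 2) x).
  by rewrite actXE; rewrite /partF actXE part_mulX.
rewrite phiX; have -> : k + e = k - 2 + e + 2 by lia.
exact: homF_actX.
Qed.

Lemma degree_of_counts (n p q r t : nat) :
  (r + n = q + p + 2 * t)%N -> - p%:Z + (- q%:Z + n%:Z) = - r%:Z + 2 * t%:Z.
Proof. by lia. Qed.

Section DegreeH.
Variables (n : nat) (s : matching n -> seq 'I_(2 * n)).
Hypothesis s_order : forall b, saddle_order b (s b).

(** Before shifting, m_{c,b,a} has degree n, one for each of the n saddles. On generators this is
    the circle count: each circle contributes -1 and each factor X_p + X_q contributes 2. *)
Lemma homF_mH c b a i j (x : F (Wcat c b)) (y : F (Wcat b a)) :
  homF i x -> homF j y -> homF (i + j + n%:Z) (mH s x y).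
Proof.
move=> hx; have -> : i + j + n%:Z = j + (i + n%:Z) by lia.
apply: homF_equivariant (mH_equiv_r s_order a x) _.
rewrite addrCA; apply: homF_equivariant (mH_equiv_l s_order c _) _ hx.
rewrite (mH1 s_order).
rewrite (degree_of_counts (card_circle_Wcat s_order c b a)).
by apply: homF_actL; apply: homF_F1.
Qed.
End DegreeH.

(** * The graded ring *)

Section Ring.
Variable n : nat.
Implicit Types (a b c : matching n) (x y z : H n) (t : Hbasis n).

Lemma homH0 i : homogH i (0 : H n).
Proof. by move=> t; rewrite ffunE eqxx. Qed.

Lemma homHB i x y : homogH i x -> homogH i y -> homogH i (x - y).
Proof.
move=> hx hy t; rewrite !ffunE => nz; have [x0|/hx //] := eqVneq (x t) 0.
by apply: hy; apply: contraNneq nz => y0; rewrite x0 y0 subr0.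
Qed.

Lemma graded_H : graded_group (@homogH n).
Proof.
split=> [i|i x y|x|I z uI hz z0 i iI].
- exact: homH0.
- exact: homHB.
- pose z i : H n := [ffun t => if degH t == i then x t else 0].
  exists (undup [seq degH t | t <- enum {: Hbasis n}]), z; split=> [|i t|].
  + exact: undup_uniq.
  + by rewrite ffunE; case: ifP => [/eqP //|]; rewrite eqxx.
  + apply/ffunP => t; rewrite sum_ffunE (bigD1_seq (degH t)) ?undup_uniq //=; last first.
      by rewrite mem_undup map_f ?mem_enum.
    rewrite ffunE eqxx big1 ?addr0 // => i /negPf ne.
    by rewrite ffunE eq_sym ne.
- apply/ffunP => t; rewrite [RHS]ffunE; apply/eqP/negPn/negP => nz.
  have dt := hz i t nz; have /ffunP/(_ t) := z0.
  rewrite sum_ffunE (bigD1_seq i) //= big1 ?addr0 => [z0t|j ne].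
    by move: nz; rewrite z0t ffunE eqxx.
  by apply/eqP/negPn/negP => /hz; rewrite dt => E; rewrite E eqxx in ne.
Qed.

Lemma componentB b a : {morph (fun x => component x b a) : x y / x - y}.
Proof. by move=> x y; apply/ffunP => f; rewrite !ffunE. Qed.

Lemma component_one_diag a : component (oneH n) a a = F1 (Wcat a a).
Proof.
apply/ffunP => f; rewrite ffunE sum_ffunE (bigD1 a) //= big1 ?addr0 => [|b ne].
  rewrite !basis_eltE; congr (Posz _); congr nat_of_bool.
  by rewrite -tag_eqE /tag_eq /= eqxx tagged_asE.
rewrite basis_eltE; case: eqP => // /(congr1 tag) [E _].
by rewrite E eqxx in ne.
Qed.

Lemma component_one_off b a : b != a -> component (oneH n) b a = 0.
Proof.
move=> ne; apply/ffunP => f; rewrite !ffunE sum_ffunE big1 // => c _.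
rewrite basis_eltE; case: eqP => // /(congr1 tag) [E1 E2].
by rewrite E1 E2 eqxx in ne.
Qed.

Variable s : matching n -> seq 'I_(2 * n).
Hypothesis s_order : forall b, saddle_order b (s b).

Lemma component_mul x y c a :
  component (mulH s x y) c a = \sum_b mH s (component x c b) (component y b a).
Proof. by apply/ffunP => f; rewrite !ffunE sum_ffunE. Qed.

Lemma H_ext x y : (forall b a, component x b a = component y b a) -> x = y.
Proof.
by move=> E; apply/ffunP => -[[b a] f]; have /ffunP/(_ f) := E b a; rewrite !ffunE.
Qed.

Let mHBl c b a (y : F (Wcat b a)) : {morph (fun x : F (Wcat c b) => mH s x y) : x1 x2 / x1 - x2}.
Proof. exact: (mH_equiv_l s_order c y).1. Qed.

Let mHBr c b a (x : F (Wcat c b)) : {morph (fun y : F (Wcat b a) => mH s x y) : y1 y2 / y1 - y2}.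
Proof. exact: (mH_equiv_r s_order a x).1. Qed.

Lemma mulHA : associative (mulH s).
Proof.
move=> x y z; apply: H_ext => d a; rewrite !component_mul.
transitivity (\sum_c \sum_b mH s (component x d c) (mH s (component y c b) (component z b a))).
  apply: eq_bigr => c _; rewrite component_mul.
  exact: (subm_sum (@mHBr d c a (component x d c))).
rewrite exchange_big; apply: eq_bigr => b _; rewrite component_mul.
rewrite (subm_sum (@mHBl d b a (component z b a))); apply: eq_bigr => c _.
by rewrite (mHA s_order).
Qed.

Lemma mulHDl : left_distributive (mulH s) +%R.
Proof.
move=> x y z; apply: H_ext => c a; rewrite component_mul.
rewrite (submD (@componentB c a)) !component_mul -big_split; apply: eq_bigr => b _.
by rewrite (submD (@componentB c b)) (submD (@mHBl c b a (component z b a))).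
Qed.

Lemma mulHDr : right_distributive (mulH s) +%R.
Proof.
move=> x y z; apply: H_ext => c a; rewrite component_mul.
rewrite (submD (@componentB c a)) !component_mul -big_split; apply: eq_bigr => b _.
by rewrite (submD (@componentB b a)) (submD (@mHBr c b a (component x c b))).
Qed.

Lemma mul1H : left_id (oneH n) (mulH s).
Proof.
move=> x; apply: H_ext => c a; rewrite component_mul (bigD1 c) //= big1 ?addr0 => [|b ne].
  by rewrite component_one_diag (mH1l s_order).
by rewrite component_one_off 1?eq_sym // (subm0 (@mHBl c b a (component x b a))).
Qed.

Lemma mulH1 : right_id (oneH n) (mulH s).
Proof.
move=> x; apply: H_ext => c a; rewrite component_mul (bigD1 a) //= big1 ?addr0 => [|b ne].
  by rewrite component_one_diag (mH1r s_order).
by rewrite component_one_off // (subm0 (@mHBr c b a (component x c b))).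
Qed.

Lemma homH_component i x : homogH i x <-> forall b a, homF (i - n%:Z) (component x b a).
Proof.
split=> [hx b a f|hx [[b a] f] nz].
  by rewrite ffunE => /hx <-; rewrite addrK.
have := hx b a f; rewrite ffunE => /(_ nz) E.
by rewrite /degH /= E subrK.
Qed.

Lemma homHM i j x y : homogH i x -> homogH j y -> homogH (i + j) (mulH s x y).
Proof.
move=> /homH_component hx /homH_component hy; apply/homH_component => c a.
rewrite component_mul; apply: (big_ind (@homF _ _ _)); [exact: homF0 | exact: homFD |].
(* Each factor is shifted by n and so is the product, so one of the two shifts cancels the degree n
   of the multiplication map. *)
move=> b _; have -> : i + j - n%:Z = (i - n%:Z) + (j - n%:Z) + n%:Z by lia.
exact: homF_mH.
Qed.

Lemma deg_ge b a (f : labeling (Wcat b a)) : - n%:Z <= deg_labeling f.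
Proof.
apply: (@le_trans _ _ (- #|{: circle (Wcat b a)}|%:Z)).
  by rewrite lerN2 lez_nat; apply: leq_card_circle.
exact: (deg_lab_ge (K := circles (Wcat b a))).
Qed.

(** The lowest degree in F(W(b)a) is minus the number of circles, which is at least -n; the shift by
    n compensates it. *)
Lemma homH_neg i x : i < 0 -> homogH i x -> x = 0.
Proof.
move=> i0 hx; apply/ffunP => t; rewrite [RHS]ffunE; apply/eqP/negPn/negP => /hx dt.
move: i0; rewrite -dt ltNge; apply/negP/negPn; rewrite /degH -[X in X <= _](addNr n%:Z).
by rewrite lerD2r; apply: deg_ge.
Qed.

(** W(a)a has exactly n circles, so its all-1 labeling has degree -n, which the shift brings to
    0. *)
Lemma homH1 : homogH 0 (oneH n).
Proof.
apply/homH_component => b a; have [<-|ne] := eqVneq b a; last first.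
  by rewrite component_one_off //; apply: homF0.
by rewrite component_one_diag sub0r; have := @homF_F1 _ (Wcat b b); rewrite (card_circle_diag s_order).
Qed.
End Ring.

Theorem proposition1 (n : nat) (s : matching n -> seq 'I_(2 * n))
    (s_order : forall b : matching n, saddle_order b (s b)) :
  nonneg_graded_ring (@homogH n) (mulH s) (oneH n).
Proof.
split.
- exact: graded_H.
- exact: homH_neg.
- exact: mulHDl.
- exact: mulHDr.
- exact: mulHA.
- exact: mul1H.
- exact: mulH1.
- exact: homHM.
- exact: homH1.
Qed.
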